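(* Let $\mathcal{M}$ be a Riemannian manifold with retraction $\mathrm{R}$, let $f \colon \mathcal{M} \to \mathbb{R}$ be of class $\mathrm{C}^2$, let $\bar x$ be a local minimum of $f$, let $f_{\mathcal{S}} = f(\bar x)$ and $\mathcal{S} = \{x \in \mathcal{M} : x \text{ is a local minimum of } f \text{ and } f(x) = f_{\mathcal{S}}\}$. Suppose that: (A2) there exists $L_H' \geq 0$ such that $f(\mathrm{R}_x(s)) - f(x) - \langle s, \nabla f(x)\rangle - \frac12\langle s, \nabla^2 f(x)[s]\rangle \leq \frac{L_H'}{6}\|s\|^3$ for all $x$ close enough to $\bar x$ and all $s \in \mathrm{T}_x\mathcal{M}$ small enough; (A3) for all $k$ the map $H_k$ used by the algorithm is linear and symmetric, and there is a constant $\beta_H \geq 0$ such that $\|H_k - \nabla^2 f(x_k)\| \leq \beta_H\|\nabla f(x_k)\|$ whenever the iterate $x_k$ is close enough to $\bar x$; ($\mu$-PŁ) for some $\mu > 0$, $f(x) - f_{\mathcal{S}} \leq \frac{1}{2\mu}\|\nabla f(x)\|^2$ for all $x$ in some neighborhood of $\bar x$. Let $\mathcal{U}$ be a neighborhood of $\bar x$. There exists a neighborhood $\mathcal{V}$ of $\bar x$ such that if a sequence of iterates generated by the Riemannian trust-region algorithm with Cauchy steps (described in the context) enters $\mathcal{V}$, then the sequence converges linearly to some $x_\infty \in \mathcal{U} \cap \mathcal{S}$ with rate $\sqrt{1 - \frac{\mu}{\lambda_{\max}}}$, where $\lambda_{\max} = \lambda_{\max}(\nabla^2 f(x_\infty))$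 is the largest eigenvalue of $\nabla^2 f(x_\infty)$.
   Context: $\mathcal{M}$ is a smooth finite-dimensional Riemannian manifold with Riemannian distance $\mathrm{dist}$; $\nabla f$, $\nabla^2 f$ are the Riemannian gradient and Hessian. A retraction is a smooth map $\mathrm{R} \colon \mathrm{T}\mathcal{M} \to \mathcal{M}$, $(x, s) \mapsto \mathrm{R}_x(s)$, such that for every $(x,s)$ the curve $c(t) = \mathrm{R}_x(ts)$ satisfies $c(0) = x$ and $c'(0) = s$. There is a constant $c_r \geq 1$ such that $\mathrm{dist}(\mathrm{R}_x(s), x) \leq c_r\|s\|$ for all sufficiently small tangent vectors. The trust-region algorithm (TR) generates $\{(x_k, \Delta_k)\}$ with $x_k \in \mathcal{M}$ and radius $\Delta_k > 0$, with parameters $\rho' \in (0, \frac14)$ and $\bar\Delta > 0$. At iteration $k$, given a linear map $H_k$ on $\mathrm{T}_{x_k}\mathcal{M}$, let $m_k(s) = f(x_k) + \langle s, \nabla f(x_k)\rangle + \frac12\langle s, H_k[s]\rangle$. A step $s_k$ with $\|s_k\| \leq \Delta_k$ is chosen, and $$\rho_k = \frac{f(x_k) - f(\mathrm{R}_{x_k}(s_k))}{m_k(0) - m_k(s_k)}$$ (with $\rho_k = 1$ if the denominator is zero). Then $x_{k+1} = \mathrm{R}_{x_k}(s_k)$ if $\rho_k > \rho'$ and $x_{k+1} = x_k$ otherwise; $\Delta_{k+1} = \frac14\Delta_k$ if $\rho_k < \frac14$, $\Delta_{k+1} = \min(2\Delta_k, \bar\Delta)$ if $\rho_k > \frac34$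 and $\|s_k\| = \Delta_k$, and $\Delta_{k+1} = \Delta_k$ otherwise. TR with Cauchy steps takes $s_k = s_k^c$, the minimizer of $m_k(s)$ subject to $\|s\| \leq \Delta_k$ and $s \in \mathrm{span}(\nabla f(x_k))$: if $\nabla f(x_k) = 0$ then $s_k^c = 0$; otherwise $s_k^c = -t_k^c\nabla f(x_k)$ with $t_k^c = \min\Big(\frac{\|\nabla f(x_k)\|^2}{\langle\nabla f(x_k), H_k[\nabla f(x_k)]\rangle}, \frac{\Delta_k}{\|\nabla f(x_k)\|}\Big)$ if $\langle\nabla f(x_k), H_k[\nabla f(x_k)]\rangle > 0$, and $t_k^c = \frac{\Delta_k}{\|\nabla f(x_k)\|}$ otherwise. In (A3) the constant $\beta_H$ and the neighborhood do not depend on $k$. Linear convergence of $x_k$ to $x_\infty$ with rate $q$ is understood in the asymptotic (R-linear) sense: $x_k \to x_\infty$ and $\limsup_{k\to\infty} \mathrm{dist}(x_k, x_\infty)^{1/k} \leq q$. *)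

(* Defs.v *)
From HB Require Import structures.
From mathcomp Require Import all_boot all_order all_algebra.
From mathcomp Require Import all_classical all_reals all_analysis.

Set Implicit Arguments.
Unset Strict Implicit.
Unset Printing Implicit Defensive.
Import Order.TTheory GRing.Theory Num.Theory.
Import numFieldNormedType.Exports.
Local Open Scope classical_set_scope.
Local Open Scope ring_scope.

(* Class C^k on an open set A of a finite-dimensional space V: all iterated
   directional derivatives up to order k exist and are continuous on A. *)
Fixpoint Ck (R : realType) (V W : normedModType R) (k : nat) (A : set V)
    (h : V -> W) : Prop :=
  if k is k'.+1 then
    (forall x, A x -> differentiable h x) /\
    (forall v, Ck k' A (fun x => 'D_v h x))
  else forall x, A x -> {for x, continuous h}.

Definition smooth (R : realType) (V W : normedModType R) (A : set V)
    (h : V -> W) : Prop :=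
  forall k, Ck k A h.

(* phi i is a homeomorphism from the open set dom i onto an open subset of R^n
   with inverse psi i; the values of phi i outside dom i and of psi i outside
   the image are irrelevant.  As for the tangent spaces of Lean's Mathlib, every
   point has a preferred chart, and a tangent vector at x is encoded by its
   coordinates, a row vector of 'rV[R]_n, in the chart preferred at x. *)
Record smoothManifold (R : realType) (n : nat) := SmoothManifold {
  carrier :> topologicalType;
  chart : Type;
  dom : chart -> set carrier;
  phi : chart -> carrier -> 'rV[R]_n;
  psi : chart -> 'rV[R]_n -> carrier;
  chart_at : carrier -> chart;
  _ : hausdorff_space carrier;
  _ : @second_countable carrier;
  _ : forall i, open (dom i);
  _ : forall i, open (phi i @` dom i);
  _ : forall i x, dom i x -> psi i (phi i x) = x;
  _ : forall i x, dom i x -> {for x, continuous (phi i)};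
  _ : forall i y, (phi i @` dom i) y -> {for y, continuous (psi i)};
  _ : forall i j, smooth (phi i @` (dom i `&` dom j)) (phi j \o psi i);
  _ : forall x, dom (chart_at x) x
}.
Arguments dom {R n s}.
Arguments phi {R n s}.
Arguments psi {R n s}.
Arguments chart_at {R n s}.

Section Manifold.
Variables (R : realType) (n : nat) (M : smoothManifold R n).
Implicit Types (i : chart M) (x : M) (y : 'rV[R]_n).

Definition img i : set 'rV[R]_n := phi i @` dom i.

(* chart i coordinates of the vector of T_x M encoded by v *)
Definition to_chart i x (v : 'rV[R]_n) : 'rV[R]_n :=
  'D_v (phi i \o psi (chart_at x)) (phi (chart_at x) x).

(* encoding of the vector of T_x M with coordinates w in the chart i *)
Definition of_chart i x (w : 'rV[R]_n) : 'rV[R]_n :=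
  'D_w (phi (chart_at x) \o psi i) (phi i x).

(* The openness clause says that h is continuous on the open set A. *)
Definition Ck_into (V : normedModType R) k (A : set V) (h : V -> M) : Prop :=
  forall i, open (A `&` h @^-1` dom i) /\
            Ck k (A `&` h @^-1` dom i) (phi i \o h).

Definition Ck_fun k (f : M -> R) : Prop :=
  forall i, Ck k (img i) (f \o psi i).

Definition velocity (c : R -> M) (t : R) : 'rV[R]_n :=
  derive1 (phi (chart_at (c t)) \o c) t.

(* The map (x, s) |-> Rt x s is smooth on TM, TM having the charts
   (y, w) |-> vector at psi i y with coordinates w in the chart i. *)
Definition is_retraction (Rt : M -> 'rV[R]_n -> M) : Prop :=
  (forall i k, Ck_into k [set z : 'rV[R]_n * 'rV[R]_n | img i z.1]
     (fun z => Rt (psi i z.1) (of_chart i (psi i z.1) z.2))) /\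
  (forall x (s : 'rV[R]_n), let c := fun t : R => Rt x (t *: s) in
     c 0 = x /\ velocity c 0 = s).

Definition local_min (f : M -> R) x : Prop := \forall y \near x, f x <= f y.

Definition local_minima_at (f : M -> R) (fS : R) : set M :=
  [set x | local_min f x /\ f x = fS].

(* The matrix gram x represents the inner product of T_x M, with respect to the
   encoding of tangent vectors. *)
Definition in_product (gram : M -> 'M[R]_n) x (u v : 'rV[R]_n) : R :=
  (u *m gram x *m v^T) 0 0.

Definition chart_gram (gram : M -> 'M[R]_n) i y : 'M[R]_n :=
  \matrix_(a, b) in_product gram (psi i y) (of_chart i (psi i y) (delta_mx 0 a))
                                           (of_chart i (psi i y) (delta_mx 0 b)).

Record riemannianMetric := RiemannianMetric {
  gram :> M -> 'M[R]_n;
  _ : forall x, (gram x)^T = gram x;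
  _ : forall x v, v != 0 -> 0 < in_product gram x v v;
  _ : forall i a b, smooth (img i) (fun y => chart_gram gram i y a b)
}.

Variable g : riemannianMetric.

Definition inner x (u v : 'rV[R]_n) : R := in_product g x u v.
Definition tnorm x (v : 'rV[R]_n) : R := Num.sqrt (inner x v v).

Definition opnorm x (A : 'rV[R]_n -> 'rV[R]_n) : R :=
  sup [set tnorm x (A s) | s in [set s | tnorm x s <= 1]].

(* P x s for all (x, s) in a neighborhood of (x0, 0) in TM *)
Definition near_zero_vector (x0 : M) (P : M -> 'rV[R]_n -> Prop) : Prop :=
  exists2 N : set M, nbhs x0 N & exists2 d : R, 0 < d &
    forall x s, N x -> tnorm x s < d -> P x s.

Definition curve_length (c : R -> M) : \bar R :=
  (\int[lebesgue_measure]_(t in `[0%R, 1%R]) (tnorm (c t) (velocity c t))%:E)%E.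

Definition C1_arc (c : R -> M) : Prop :=
  exists A : set R, [/\ open A, `[0, 1] `<=` A & Ck_into 1 A c].

(* s is the list of the successive C^1 pieces, each one parametrized by [0, 1],
   of a piecewise C^1 curve from x to y. *)
Fixpoint joins (x : M) (s : seq (R -> M)) (y : M) : Prop :=
  if s is c :: s' then [/\ C1_arc c, c 0 = x & joins (c 1) s' y] else x = y.

(* +oo when x and y lie in different connected components *)
Definition rdist (x y : M) : \bar R :=
  ereal_inf [set (\sum_(c <- s) curve_length c)%E | s in [set s | joins x s y]].

(* <grad f x, s>_x = D f(x)[s] for all s *)
Definition grad (f : M -> R) x : 'rV[R]_n :=
  (\row_a 'D_(delta_mx 0 a) (f \o psi (chart_at x)) (phi (chart_at x) x))
  *m invmx (g x).

Definition christoffel i y (k a b : 'I_n) : R :=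
  let G := chart_gram g i in
  let d (c : 'I_n) (p q : 'I_n) := 'D_(delta_mx 0 c) (fun z => G z p q) y in
  2^-1 * \sum_(l < n) invmx (G y) k l * (d a b l + d b a l - d l a b).

(* Levi-Civita connection, computed in the chart preferred at x, in which
   the coordinates of s are s itself *)
Definition nabla (X : M -> 'rV[R]_n) x (s : 'rV[R]_n) : 'rV[R]_n :=
  let i := chart_at x in
  let Xi (y : 'rV[R]_n) := to_chart i (psi i y) (X (psi i y)) in
  'D_s Xi (phi i x) +
  \row_k \sum_(a < n) \sum_(b < n)
    s 0 a * Xi (phi i x) 0 b * christoffel i (phi i x) k a b.

Definition hess (f : M -> R) x (s : 'rV[R]_n) : 'rV[R]_n := nabla (grad f) x s.

(* Largest eigenvalue of a self-adjoint A: the supremum is then attained, except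
   in dimension 0, where it is 0. *)
Definition lambda_max (A : 'rV[R]_n -> 'rV[R]_n) : R :=
  sup [set a : R | exists2 v : 'rV[R]_n, v != 0 & A v = a *: v].

Definition linear_cvg (x : nat -> M) (xoo : M) (q : R) : Prop :=
  x k @[k --> \oo] --> xoo /\
  (limn_esup (fun k => poweR (rdist (x k) xoo) (k%:R^-1)%R) <= q%:E)%E.

Section TrustRegion.
Variables (f : M -> R) (Rt : M -> 'rV[R]_n -> M).
Implicit Types (A : 'rV[R]_n -> 'rV[R]_n) (s : 'rV[R]_n).

Definition tr_model x A s : R :=
  f x + inner x s (grad f x) + 2^-1 * inner x s (A s).

Definition tr_ratio x A s : R :=
  let d := tr_model x A 0 - tr_model x A s in
  if d == 0 then 1 else (f x - f (Rt x s)) / d.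

Definition cauchy_time x A (D : R) : R :=
  let G := grad f x in
  if 0 < inner x G (A G) then
    Num.min (tnorm x G ^+ 2 / inner x G (A G)) (D / tnorm x G)
  else D / tnorm x G.

Definition cauchy_step x A (D : R) : 'rV[R]_n :=
  if grad f x == 0 then 0 else - cauchy_time x A D *: grad f x.

Definition trust_region (rho' Dbar : R) (x : nat -> M) (D : nat -> R)
    (H : nat -> 'rV[R]_n -> 'rV[R]_n) (s : nat -> 'rV[R]_n) : Prop :=
  forall k, let rho := tr_ratio (x k) (H k) (s k) in
  [/\ 0 < D k,
      tnorm (x k) (s k) <= D k,
      x k.+1 = (if rho' < rho then Rt (x k) (s k) else x k) &
      D k.+1 = (if rho < 1 / 4 then D k / 4
                else if (3 / 4 < rho) && (tnorm (x k) (s k) == D k)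
                     then Num.min (2 * D k) Dbar
                else D k)].

Definition cauchy_steps (x : nat -> M) (D : nat -> R)
    (H : nat -> 'rV[R]_n -> 'rV[R]_n) (s : nat -> 'rV[R]_n) : Prop :=
  forall k, s k = cauchy_step (x k) (H k) (D k).

Definition hyp_A3 (betaH : R) (N : set M) (x : nat -> M)
    (H : nat -> 'rV[R]_n -> 'rV[R]_n) : Prop :=
  forall k,
  [/\ linear (H k),
      forall u v, inner (x k) (H k u) v = inner (x k) u (H k v) &
      N (x k) -> opnorm (x k) (fun v => H k v - hess f (x k) v)
                 <= betaH * tnorm (x k) (grad f (x k))].

End TrustRegion.
End Manifold.

(* Main.v *)
Require Import Defs.
From HB Require Import structures.
From mathcomp Require Import all_boot all_order all_algebra.
From mathcomp Require Import all_classical all_reals all_analysis.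
From mathcomp Require Import ring lra.
Import Order.TTheory GRing.Theory Num.Theory.
Import numFieldNormedType.Exports.
Local Open Scope classical_set_scope.
Local Open Scope ring_scope.

(** The quadratic form of the Hessian is only ever needed along the gradient,
where [<grad f, Hess f grad f>] is half the derivative of [|grad f|^2] along
[grad f]; this is a first-order expression, so it can be computed in any fixed
chart and is continuous there.  It is bounded above near a critical point by
[(lambda_max + e) |grad f|^2], and bounded below by [(mu - e) |grad f|^2]: if it
were smaller, one retracted gradient step would, by A2, decrease [f] by more than
the PL bound allows.  Hence near [xbar] the Cauchy step has length at most a
constant times [|grad f|], the ratio [rho] exceeds 3/4, and the radius stays
bounded away from 0.  With [gap = f - f xbar], sufficient decrease and PL give
[|x_(k+1) - x_k| <= K (sqrt gap_k - sqrt gap_(k+1))] in a chart, which confines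
the iterates and makes them converge at the speed of [sqrt gap].  Eventually the
radius is inactive and the decrease is at least
[(1 - e) |grad f|^2 / (2 (lambda_max + 2 e))], whence the rate by PL. *)

(** * Differential calculus *)

(** Tangent vectors at different points are encoded in unrelated preferred charts, so a vector field
    need not be continuous in its encoding. Estimates are therefore moved to one fixed chart, and
    charts are compared through scalars such as [f] and the squared gradient norm. The neighborhood
    has to be chosen before the sequence, hence before the radius with which the iterates enter it,
    which may be arbitrarily small. The path-length bound must not see that radius: for a step of
    length [t * S], with [S] the gradient norm, the decrease is of order [t * S ^+ 2], so [t] drops
    out of the comparison. The entry radius affects only the coarse factor of [gap_contraction]. As
    the sharp rate refers to the Hessian at the limit, this coarse factor must first produce a
    limit. Margins: along the gradient the Hessian is at least [mu / 2], A3 may take away [mu / 4],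
    and [mu / 4] is left for [H k]. A relative error below 1/4 between actual and model decrease
    gives the ratio 3/4. *)

Lemma near_eq_differentiable (R : realType) (V W : normedModType R)
  (f g : V -> W) (a : V) :
  (\near a, f a = g a) -> differentiable f a -> differentiable g a.
Proof.
move=> fg df; have fga := nbhs_singleton fg.
have E : g \o shift a = cst (g a) + 'd f a +o_ 0 id.
  rewrite -fga; apply/eqaddoP => e e0.
  have /eqaddoP/(_ e e0) := diff_locally df.
  have : \forall x \near (0 : V), f (x + a) = g (x + a).
    by move: fg; rewrite (near_shift 0) /= subr0.
  apply: filterS2 => x /= fgx; rewrite !fctE /= ?fgx; congr (_ <= _).
have dE : 'd g a = 'd f a :> (V -> W).
  by apply: diff_unique => //; exact: diff_continuous.
by apply/diff_locallyP; split; rewrite dE //; exact: diff_continuous.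
Qed.

Section Calculus.
Context {R : realType}.

Lemma differentiable_bigsum (V W : normedModType R) (I : Type) (r : seq I)
  (F : I -> V -> W) (x : V) :
  (forall i, differentiable (F i) x) ->
  differentiable (fun y => \sum_(i <- r) F i y) x.
Proof.
move=> dF; elim: r => [|i r IH].
  by under eq_fun do rewrite big_nil; exact: differentiable_cst.
by under eq_fun do rewrite big_cons; exact: differentiableD.
Qed.

Lemma differentiable_bigprod (V : normedModType R) (I : Type) (r : seq I)
  (F : I -> V -> R) (x : V) :
  (forall i, differentiable (F i) x) ->
  differentiable (fun y => \prod_(i <- r) F i y) x.
Proof.
move=> dF; elim: r => [|i r IH].
  by under eq_fun do rewrite big_nil; exact: differentiable_cst.
by under eq_fun do rewrite big_cons; exact: differentiableM.
Qed.

Lemma differentiable_mxP (V : normedModType R) (m n : nat)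
  (A : V -> 'M[R]_(m, n)) (x : V) :
  differentiable A x <-> forall i j, differentiable (fun y => A y i j) x.
Proof.
split=> [dA i j|dA].
  exact: (@differentiable_comp R V 'M[R]_(m, n) R A (fun B => B i j) x dA
    (differentiable_coord (A x) i j)).
have -> : A = fun y => \sum_i \sum_j A y i j *: delta_mx i j.
  by apply/funext => y; exact: matrix_sum_delta.
do 2 apply: differentiable_bigsum => ?.
exact: differentiableZl.
Qed.

Lemma differentiable_mulmx (V : normedModType R) (m n p : nat)
  (A : V -> 'M[R]_(m, n)) (B : V -> 'M[R]_(n, p)) (x : V) :
  differentiable A x -> differentiable B x ->
  differentiable (fun y => A y *m B y) x.
Proof.
move=> /differentiable_mxP dA /differentiable_mxP dB.
apply/differentiable_mxP => i j; under eq_fun do rewrite mxE.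
by apply: differentiable_bigsum => k; exact: differentiableM.
Qed.

Lemma differentiable_trmx (V : normedModType R) (m n : nat)
  (A : V -> 'M[R]_(m, n)) (x : V) :
  differentiable A x -> differentiable (fun y => (A y)^T) x.
Proof.
move=> /differentiable_mxP dA.
by apply/differentiable_mxP => i j; under eq_fun do rewrite mxE.
Qed.

Lemma differentiable_det (V : normedModType R) (n : nat)
  (A : V -> 'M[R]_n) (x : V) :
  differentiable A x -> differentiable (fun y => \det (A y)) x.
Proof.
move=> /differentiable_mxP dA; rewrite /determinant.
apply: differentiable_bigsum => s; apply: differentiableM.
  exact: differentiable_cst.
exact: differentiable_bigprod.
Qed.

(** Cramer's rule: adjugate over determinant, both polynomial in the entries. [invmx] follows this
    formula on invertible matrices only, hence the condition on a whole neighborhood. *)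
Lemma differentiable_invmx (V : normedModType R) (n : nat)
  (A : V -> 'M[R]_n) (x : V) :
  differentiable A x -> (\forall y \near x, A y \in unitmx) ->
  differentiable (fun y => invmx (A y)) x.
Proof.
move=> dA uA.
have /(@near_eq_differentiable R) : \forall y \near x,
    (\det (A y))^-1 *: \adj (A y) = invmx (A y).
  by apply: filterS uA => y; rewrite /invmx => ->.
apply; apply/differentiable_mxP => i j.
under eq_fun do rewrite !mxE.
have dA' := (@differentiable_mxP V _ _ A x).1 dA.
apply: differentiableM.
  apply: differentiableV; first exact: differentiable_det.
  by have := nbhs_singleton uA; rewrite unitmxE unitfE.
rewrite /cofactor; apply: differentiableM; first exact: differentiable_cst.
apply: differentiable_det; apply/differentiable_mxP => k l.
by under eq_fun do rewrite !mxE.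
Qed.

Lemma derive_comp (U V W : normedModType R) (u : U -> V) (h : V -> W) x v :
  differentiable u x -> differentiable h (u x) ->
  'D_v (h \o u) x = 'D_('D_v u x) h (u x).
Proof.
move=> du dh; rewrite !deriveE //; last exact: differentiable_comp.
by rewrite diff_comp.
Qed.

Lemma derive_rVE (n : nat) (W : normedModType R) (h : 'rV[R]_n -> W) x v :
  differentiable h x ->
  'D_v h x = \sum_i v 0 i *: 'D_(delta_mx 0 i) h x.
Proof.
move=> dh; rewrite deriveE // {1}(row_sum_delta v) linear_sum.
by apply: eq_bigr => i _; rewrite linearZ deriveE.
Qed.

Lemma derive_coord (V : normedModType R) (m n : nat)
  (A : V -> 'M[R]_(m, n)) x v i j :
  differentiable A x -> ('D_v A x) i j = 'D_v (fun y => A y i j) x.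
Proof. by move=> dA; rewrite derive_mx ?mxE //; exact: diff_derivable. Qed.

Lemma derive_mulmx (V : normedModType R) (m n p : nat)
  (A : V -> 'M[R]_(m, n)) (B : V -> 'M[R]_(n, p)) (x v : V) :
  differentiable A x -> differentiable B x ->
  'D_v (fun y => A y *m B y) x = 'D_v A x *m B x + A x *m 'D_v B x.
Proof.
move=> dA dB; apply/matrixP => i j.
rewrite derive_coord; last exact: differentiable_mulmx.
under [in LHS]eq_fun do rewrite mxE.
have dA' := (@differentiable_mxP V _ _ A x).1 dA.
have dB' := (@differentiable_mxP V _ _ B x).1 dB.
have -> : (fun y => \sum_j0 A y i j0 * B y j0 j) =
    \sum_j0 ((fun y => A y i j0) \* (fun y => B y j0 j)).
  by apply/funext => y; rewrite fct_sumE.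
rewrite derive_sum; last first.
  by move=> k; apply: derivableM; exact: diff_derivable.
rewrite !mxE -big_split /=; apply: eq_bigr => k _.
rewrite deriveM; [|exact: diff_derivable..].
by rewrite !derive_coord // addrC ![_ *: _]mulrC [X in X + _]mulrC.
Qed.

Lemma derive_trmx (V : normedModType R) (m k : nat) (A : V -> 'M[R]_(m, k))
  (x v : V) : differentiable A x -> 'D_v (fun y => (A y)^T) x = ('D_v A x)^T.
Proof.
move=> dA; apply/matrixP => a b; rewrite mxE !derive_coord //.
  by congr ('D_v _ x); apply/funext => z; rewrite mxE.
exact: differentiable_trmx.
Qed.

Lemma differentiable_line (V : normedModType R) (x v : V) (t : R) :
  differentiable (fun t : R => x + t *: v) t.
Proof. by []. Qed.

Lemma derive_line (V : normedModType R) (x v : V) (t : R) :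
  'D_1 (fun t : R => x + t *: v) t = v.
Proof.
rewrite deriveE; last exact: differentiable_line.
have -> : (fun t : R => x + t *: v) = cst x + ( *:%R ^~ v) by [].
by rewrite diff_val /= add0r scale1r.
Qed.

Lemma MVT_line (V : normedModType R) (h : V -> R) (x v : V) :
  (forall t, 0 <= t <= 1 -> differentiable h (x + t *: v)) ->
  exists2 t, 0 <= t <= 1 & h (x + v) - h x = 'D_v h (x + t *: v).
Proof.
move=> dh; pose u (t : R) := x + t *: v.
have du t : differentiable u t by exact: differentiable_line.
have Du t : 'D_1 u t = v by exact: derive_line.
have [|||t t01 E] := @MVT_segment R (h \o u) (fun t => 'D_v h (u t)) 0 1.
- exact: ler01.
- move=> t; rewrite in_itv /= => /andP[t0 t1].
  have dht : differentiable h (u t) by apply: dh; rewrite !ltW.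
  apply: DeriveDef; first by apply/derivable1_diffP; exact: differentiable_comp.
  by rewrite derive_comp // Du.
- apply: continuous_in_subspaceT => t; rewrite inE /= in_itv /= => t01.
  apply: differentiable_continuous; apply: differentiable_comp => //.
  exact: dh.
exists t; first by move: t01; rewrite in_itv.
by move: E; rewrite /= /u scale1r scale0r addr0 subr0 mulr1.
Qed.

End Calculus.

(** * Mixed second derivatives and a local Lipschitz bound *)

Section SecondOrder.
Context {R : realType}.

Lemma near_norm_ball (V : normedModType R) (a : V) (P : set V) :
  nbhs a P -> exists2 r : R, 0 < r & forall x, `|x - a| < r -> P x.
Proof.
move=> /nbhs_ballP[r /= r0 rP]; exists r => // x xr; apply: rP.
by rewrite -ball_normE /= distrC.
Qed.

(** The mean value theorem twice: for the difference of [h] at [y + t *: v] and [y] along [t *: u],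
    then for ['D_u h] along [t *: v]. *)
Lemma second_difference (V : normedModType R) (h : V -> R) (a u v : V) (t : R) :
  (forall c d, 0 <= c <= 1 -> 0 <= d <= 1 ->
     differentiable h (a + c *: (t *: u) + d *: (t *: v))) ->
  (forall c d, 0 <= c <= 1 -> 0 <= d <= 1 ->
     differentiable ('D_u h) (a + c *: (t *: u) + d *: (t *: v))) ->
  exists c d, [/\ 0 <= c <= 1, 0 <= d <= 1 &
    h (a + t *: u + t *: v) - h (a + t *: u) - (h (a + t *: v) - h a)
    = t ^+ 2 * 'D_v ('D_u h) (a + c *: (t *: u) + d *: (t *: v))].
Proof.
move=> dh ddh.
have I0 : 0 <= (0 : R) <= 1 by rewrite lexx ler01.
have I1 : 0 <= (1 : R) <= 1 by rewrite lexx ler01.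
have dh1 c : 0 <= c <= 1 -> differentiable h (a + c *: (t *: u)).
  by move=> c01; have := dh c 0 c01 I0; rewrite scale0r addr0.
have dh2 c : 0 <= c <= 1 -> differentiable h (a + c *: (t *: u) + t *: v).
  by move=> c01; have := dh c 1 c01 I1; rewrite scale1r.
have dsh c : 0 <= c <= 1 ->
    differentiable (h \o (fun y => y + t *: v)) (a + c *: (t *: u)).
  move=> c01; apply: differentiable_comp; last exact: dh2.
  by apply: differentiableD => //; exact: differentiable_cst.
have Dsh c w : 0 <= c <= 1 ->
    'D_w (h \o (fun y => y + t *: v)) (a + c *: (t *: u)) =
    'D_w h (a + c *: (t *: u) + t *: v).
  move=> c01; rewrite derive_comp; last exact: dh2.
    congr ('D_ _ h _); rewrite deriveE //.
      have -> : (fun y : V => y + t *: v) = id + cst (t *: v) by [].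
      by rewrite diff_val /= addr0.
    by apply: differentiableD => //; exact: differentiable_cst.
pose k y := (h \o (fun y => y + t *: v)) y - h y.
have [|c c01 E1] := @MVT_line R V k a (t *: u).
  by move=> c c01; apply: differentiableB; [exact: dsh|exact: dh1].
have dk : 'D_(t *: u) k (a + c *: (t *: u)) =
    t * ('D_u h (a + c *: (t *: u) + t *: v) - 'D_u h (a + c *: (t *: u))).
  have -> : k = (h \o (fun y => y + t *: v)) - h by [].
  have D1 : derivable (h \o (fun y => y + t *: v)) (a + c *: (t *: u)) (t *: u).
    by apply: diff_derivable; exact: dsh.
  have D2 : derivable h (a + c *: (t *: u)) (t *: u).
    by apply: diff_derivable; exact: dh1.
  rewrite (deriveB D1 D2) Dsh // mulrBr.
  by rewrite !(deriveE _ (dh1 _ c01)) !(deriveE _ (dh2 _ c01)) !linearZ.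
have [|d d01 E2] := @MVT_line R V ('D_u h) (a + c *: (t *: u)) (t *: v).
  by move=> d d01; exact: ddh.
exists c, d; split => //.
have -> : h (a + t *: u + t *: v) - h (a + t *: u) - (h (a + t *: v) - h a) =
    k (a + t *: u) - k a by rewrite /k /=; ring.
rewrite E1 dk E2 deriveE; last exact: ddh.
by rewrite linearZ deriveE; [rewrite expr2 -mulrA|exact: ddh].
Qed.

(** Schwarz's theorem: the second difference is symmetric in [u] and [v], so the two mixed
    derivatives agree at two points of a small parallelogram, and by continuity each is within
    [e / 2] of its value at [a]. *)
Lemma Ck2_symmetric (V : normedModType R) (A : set V) (h : V -> R) (a u v : V) :
  open A -> Ck 2 A h -> A a -> 'D_v ('D_u h) a = 'D_u ('D_v h) a.
Proof.
move=> oA [dh hh] Aa; apply/eqP/contraT; rewrite -subr_eq0 => ne.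
set e := `|'D_v ('D_u h) a - 'D_u ('D_v h) a|.
have e0 : 0 < e by rewrite normr_gt0.
have ddh w x : A x -> differentiable ('D_w h) x by have [+ _] := hh w; apply.
have cdh w z : {for a, continuous ('D_z ('D_w h))}.
  by have [_ /(_ z)] := hh w; apply.
have e2 : 0 < e / 2 by exact: divr_gt0.
have [r1 r10 rB1] := near_norm_ball _ _ _ (open_nbhs_nbhs (conj oA Aa)).
have [r2 r20 rB2] := near_norm_ball _ _ _ ((cvgrPdist_lt _ _).1 (cdh u v) _ e2).
have [r3 r30 rB3] := near_norm_ball _ _ _ ((cvgrPdist_lt _ _).1 (cdh v u) _ e2).
pose r := Num.min r1 (Num.min r2 r3).
have r0 : 0 < r by rewrite !lt_min r10 r20 r30.
have rB x : `|x - a| < r -> [/\ A x,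
    `|'D_v ('D_u h) a - 'D_v ('D_u h) x| < e / 2
  & `|'D_u ('D_v h) a - 'D_u ('D_v h) x| < e / 2].
  rewrite !lt_min => /andP[x1 /andP[x2 x3]].
  by split; [exact: rB1|exact: rB2|exact: rB3].
have s0 : 0 < `|u| + `|v| + 1 by rewrite ltr_wpDl // addr_ge0.
(* This puts the whole parallelogram at [a] with sides [t *: u] and [t *: v] in the ball of radius
   [r]; the added 1 covers [u = v = 0]. *)
have [t t0 tE] : exists2 t, 0 < t & t * (`|u| + `|v|) < r.
  exists (r / (`|u| + `|v| + 1)); first by rewrite divr_gt0.
  by rewrite mulrAC ltr_pdivrMr // ltr_pM2l // ltrDl.
have Bt (w z : V) c d : `|w| + `|z| = `|u| + `|v| -> 0 <= c <= 1 -> 0 <= d <= 1 ->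
    `|a + c *: (t *: w) + d *: (t *: z) - a| < r.
  move=> wz /andP[c0 c1] /andP[d0 d1]; rewrite -(addrA a) [a + _]addrC addrK.
  rewrite (le_lt_trans (ler_normD _ _)) // !normrZ !(ger0_norm c0) !(ger0_norm d0).
  rewrite (gtr0_norm t0) (@le_lt_trans _ _ (t * (`|w| + `|z|))) //.
    by rewrite mulrDr lerD // ler_piMl // mulr_ge0 // ltW.
  by rewrite wz.
have [||c [d [c01 d01 E]]] := @second_difference V h a u v t.
- by move=> c d c01 d01; have [Ax _ _] := rB _ (Bt u v c d erefl c01 d01); exact: dh.
- by move=> c d c01 d01; have [Ax _ _] := rB _ (Bt u v c d erefl c01 d01); exact: ddh.
have vu : `|v| + `|u| = `|u| + `|v| by rewrite addrC.
have [||c' [d' [c01' d01' E']]] := @second_difference V h a v u t.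
- by move=> ? ? c1 d1; have [Ax _ _] := rB _ (Bt v u _ _ vu c1 d1); exact: dh.
- by move=> ? ? c1 d1; have [Ax _ _] := rB _ (Bt v u _ _ vu c1 d1); exact: ddh.
have [_ P1 _] := rB _ (Bt u v c d erefl c01 d01).
have [_ _ P2] := rB _ (Bt v u c' d' vu c01' d01').
rewrite (addrAC a (t *: v)) in E'.
have swap (p q r' s : R) : p - q - (r' - s) = p - r' - (q - s) by ring.
have close (p q r' s : R) : r' = s -> `|p - r'| < e / 2 -> `|q - s| < e / 2 ->
    `|p - q| < e.
  move=> <- pr qr; rewrite (le_lt_trans (ler_distD r' p q)) // (splitr e).
  by rewrite ltrD // distrC.
have : e < e; last by rewrite ltxx.
apply: (close _ _ _ _ _ P1 P2).
have t2 : t ^+ 2 != 0 by rewrite expf_neq0 // gt_eqF.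
apply: (mulfI t2); apply: etrans (esym E) _; apply: etrans _ E'; exact: swap.
Qed.

Lemma mx_coord_le (m n : nat) (A : 'M[R]_(m, n)) i j : `|A i j| <= `|A|.
Proof.
by rewrite [leRHS]/Num.Def.normr /= mx_normrE; exact: (le_bigmax _ _ (i, j)).
Qed.

Lemma mx_norm_le (m n : nat) (A : 'M[R]_(m, n)) c :
  0 <= c -> (forall i j, `|A i j| <= c) -> `|A| <= c.
Proof.
rewrite [`|A|]/Num.Def.normr /= mx_normrE => c0 Ac.
by apply: bigmax_le => // -[i j] _; exact: Ac.
Qed.

(** [Ck 1] controls derivatives one direction at a time, so only displacements along finitely many
    directions [b] are considered. For the retraction these are the fiber directions of the tangent
    bundle. *)
Lemma C1_lipschitz_span (V : normedModType R) (m n : nat) (A : set V)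
  (h : V -> 'rV[R]_m) (a : V) (b : 'I_n -> V) :
  open A -> Ck 1 A h -> A a ->
  exists2 C, 0 <= C & exists2 d, 0 < d &
    forall x (w : 'rV[R]_n), `|x - a| < d -> `|w| < d ->
      `|h (x + \sum_i w 0 i *: b i) - h x| <= C * `|w|.
Proof.
move=> oA [dh ch] Aa.
pose M := \sum_i (`|'D_(b i) h a| + 1).
have M0 : 0 <= M by apply: sumr_ge0 => i _; rewrite addr_ge0.
have [r r0 rB] : exists2 r, 0 < r & forall x, `|x - a| < r ->
    A x /\ forall i, `|'D_(b i) h x| <= `|'D_(b i) h a| + 1.
  apply: near_norm_ball; near=> x; split.
    by near: x; exact: open_nbhs_nbhs.
  move=> i; move: i; near: x; apply: filter_forall => i.
  have /cvgrPdist_lt/(_ 1 ltr01) := ch (b i) a Aa.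
  apply: filterS => x /= ax.
  rewrite -lerBlDl; apply: le_trans (ltW ax).
  by rewrite distrC (le_trans _ (lerB_dist _ _)).
pose S := \sum_i `|b i|.
have S0 : 0 <= S by apply: sumr_ge0.
have S1 : 0 < S + 1 by rewrite ltr_wpDl.
exists M => //; exists (Num.min (r / 2) (r / 2 / (S + 1))).
  by rewrite lt_min !divr_gt0.
move=> x w; rewrite !lt_min => /andP[xa _] /andP[_ wr].
set z := \sum_i w 0 i *: b i.
have zn : `|z| <= `|w| * S.
  rewrite (le_trans (ler_norm_sum _ _ _)) // mulr_sumr ler_sum // => i _.
  by rewrite normrZ ler_wpM2r // mx_coord_le.
have zr : `|z| < r / 2.
  rewrite (le_lt_trans zn) // (@le_lt_trans _ _ (`|w| * (S + 1))) //.
    by rewrite ler_wpM2l // lerDl.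
  by rewrite -ltr_pdivlMr.
have pr t : 0 <= t <= 1 -> `|x + t *: z - a| < r.
  move=> /andP[t0 t1]; rewrite addrAC (le_lt_trans (ler_normD _ _)) //.
  rewrite (splitr r) ltrD // (le_lt_trans _ zr) // normrZ ger0_norm //.
  by rewrite ler_piMl.
apply: mx_norm_le => [|i j]; first by rewrite mulr_ge0.
have [|t t01 E] := @MVT_line R V (fun y => h y i j) x z.
  move=> t t01; have [Ax _] := rB _ (pr _ t01).
  exact: (differentiable_mxP V 1 m h _).1 (dh _ Ax) i j.
rewrite !mxE E; have [Ax Db] := rB _ (pr _ t01).
rewrite -derive_coord; last exact: dh.
rewrite (le_trans (mx_coord_le _ _ _ _ _)) // deriveE; last exact: dh.
rewrite linear_sum (le_trans (ler_norm_sum _ _ _)) // mulrC mulr_sumr ler_sum // => k _.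
rewrite linearZ normrZ ler_pM // ?mx_coord_le //.
by rewrite -deriveE; [exact: Db|exact: dh].
Unshelve. all: by end_near. Qed.

End SecondOrder.

(** * Symmetric bilinear forms and the Rayleigh quotient *)

Section Forms.
Context {R : realType}.

Definition bil {n : nat} (P : 'M[R]_n) (u v : 'rV[R]_n) : R := (u *m P *m v^T) 0 0.

Section FormTheory.
Context {n : nat}.
Implicit Types (P Q G : 'M[R]_n) (u v w : 'rV[R]_n) (a : R).

Lemma bilDl P u v w : bil P (u + v) w = bil P u w + bil P v w.
Proof. by rewrite /bil !mulmxDl mxE. Qed.
Lemma bilDr P u v w : bil P w (u + v) = bil P w u + bil P w v.
Proof. by rewrite /bil linearD mulmxDr mxE. Qed.
Lemma bilZl P a u w : bil P (a *: u) w = a * bil P u w.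
Proof. by rewrite /bil -!scalemxAl mxE. Qed.
Lemma bilZr P a u w : bil P w (a *: u) = a * bil P w u.
Proof. by rewrite /bil linearZ -scalemxAr mxE. Qed.
Lemma bilNl P u w : bil P (- u) w = - bil P u w.
Proof. by rewrite -scaleN1r bilZl mulN1r. Qed.
Lemma bilNr P u w : bil P w (- u) = - bil P w u.
Proof. by rewrite -scaleN1r bilZr mulN1r. Qed.
Lemma bil0l P w : bil P 0 w = 0. Proof. by rewrite /bil !mul0mx mxE. Qed.
Lemma bil0r P w : bil P w 0 = 0. Proof. by rewrite /bil trmx0 mulmx0 mxE. Qed.
Lemma bilBmx P Q u v : bil (P - Q) u v = bil P u v - bil Q u v.
Proof. by rewrite /bil mulmxBr mulmxBl !mxE. Qed.
Lemma bilZmx a P u v : bil (a *: P) u v = a * bil P u v.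
Proof. by rewrite /bil -scalemxAr -scalemxAl mxE. Qed.
Lemma bil_tr P u v : bil P^T u v = bil P v u.
Proof. by rewrite /bil -[u in LHS]trmxK -trmx_mul -mulmxA -trmx_mul mxE. Qed.
Lemma bilC P u v : P^T = P -> bil P u v = bil P v u.
Proof. by move=> sP; rewrite -{1}sP bil_tr. Qed.

Lemma bilE P u v : bil P u v = \sum_i \sum_j u 0 i * P i j * v 0 j.
Proof.
rewrite /bil mxE exchange_big /=; apply: eq_bigr => j _.
by rewrite !mxE mulr_suml.
Qed.

Lemma bil_le P u v : `|bil P u v| <= (n%:R ^+ 2 * `|P|) * (`|u| * `|v|).
Proof.
rewrite bilE.
have -> : n%:R ^+ 2 * `|P| * (`|u| * `|v|) =
    \sum_(i < n) \sum_(j < n) `|P| * (`|u| * `|v|).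
  by rewrite !sumr_const !card_ord -[RHS]mulr_natl -[X in _ = _ * X]mulr_natl; ring.
rewrite (le_trans (ler_norm_sum _ _ _)) // ler_sum // => i _.
rewrite (le_trans (ler_norm_sum _ _ _)) // ler_sum // => j _.
rewrite !normrM mulrA (mulrC `|u 0 i|).
by apply: ler_pM; rewrite ?mulr_ge0 //; [apply: ler_pM|]; rewrite // mx_coord_le.
Qed.

(** If [bil P u v] were nonzero, the form at [u + t *: v], which has no constant term in [t], would
    be negative for some [t]. The minimizer is [- b / c]; the proof divides by [c + 1] because [c]
    may vanish. *)
Lemma psd_kernel P u : P^T = P -> (forall v, 0 <= bil P v v) ->
  bil P u u = 0 -> u *m P = 0.
Proof.
move=> sP P0 uu.
have z v : bil P u v = 0.
  apply/eqP/contraT => ne; set b := bil P u v in ne *; set c := bil P v v.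
  have c0 : 0 <= c by exact: P0.
  pose t := - b / (c + 1).
  have := P0 (u + t *: v).
  rewrite !(bilDl, bilDr, bilZl, bilZr) uu (bilC _ v u) // -/b -/c.
  have -> : 0 + t * b + (t * b + t * (t * c)) =
      - (b ^+ 2 * (c + 2) / (c + 1) ^+ 2).
    have c1 : c + 1 != 0 by rewrite gt_eqF // ltr_wpDl.
    by rewrite /t; field.
  rewrite oppr_ge0 leNgt => /negP[].
  by rewrite divr_gt0 // ?exprn_gt0 ?ltr_wpDl // mulr_gt0 ?ltr_wpDl // exprn_even_gt0.
apply/rowP => i; have := z (delta_mx 0 i).
by rewrite /bil trmx_delta -colE !mxE.
Qed.

Definition posdef G : Prop := G^T = G /\ forall v, v != 0 -> 0 < bil G v v.

Lemma posdef_ge0 G v : posdef G -> 0 <= bil G v v.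
Proof.
by move=> [_ G0]; have [->|/G0/ltW//] := eqVneq v 0; rewrite bil0l.
Qed.

Lemma posdef_unit G : posdef G -> G \in unitmx.
Proof.
move=> [_ G0]; rewrite -row_free_unit; apply: inj_row_free => v vG0.
by apply/eqP/contraT => /G0; rewrite /bil vG0 mul0mx mxE ltxx.
Qed.

Lemma posdef_CS G u v : posdef G -> (bil G u v) ^+ 2 <= bil G u u * bil G v v.
Proof.
move=> pG; have [sG G0] := pG.
have [->|v0] := eqVneq v 0; first by rewrite !bil0r mulr0 expr0n.
have c0 := G0 _ v0; set c := bil G v v in c0 *; set b := bil G u v.
have := posdef_ge0 G (u - (b / c) *: v) pG.
rewrite !(bilDl, bilDr, bilNl, bilNr, bilZl, bilZr) (bilC _ v u) // -/b -/c => h.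
suff : 0 <= (bil G u u * c - b ^+ 2) / c.
  by rewrite pmulr_lge0 ?invr_gt0 // subr_ge0.
apply: le_trans h _; rewrite le_eqVlt; apply/orP; left; apply/eqP.
by field; rewrite gt_eqF.
Qed.

(** Cauchy-Schwarz against row [i] of [invmx G], the vector that represents the [i]-th coordinate
    for the inner product [G]. *)
Lemma posdef_coord G v i : posdef G ->
  v 0 i ^+ 2 <= (invmx G) i i * bil G v v.
Proof.
move=> pG; have uG := posdef_unit _ pG; have [sG _] := pG.
have sI : (invmx G)^T = invmx G by rewrite trmx_inv sG.
pose e := row i (invmx G).
have ev : bil G e v = v 0 i.
  by rewrite /bil /e -row_mul mulVmx // row1 -rowE !mxE.
have ee : bil G e e = invmx G i i.
  by rewrite /bil {1}/e -row_mul mulVmx // row1 -rowE !mxE.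
by rewrite -ev -ee; exact: posdef_CS.
Qed.

(** The quotient is homogeneous of degree 0, so its maximum over the compact unit sphere of the max
    norm is a global one. *)
Lemma rayleigh_quotient_max (S G : 'M[R]_n) (w : 'rV[R]_n) :
  posdef G -> S^T = S -> w != 0 ->
  exists l (c : 'rV[R]_n), [/\ c != 0, c *m S = l *: (c *m G) &
    forall v, bil S v v <= l * bil G v v].
Proof.
move=> pG sS w0; have [sG G0] := pG.
pose A : set 'rV[R]_n := [set v | `|v| = 1].
pose r (v : 'rV[R]_n) := bil S v v / bil G v v.
have dbil P v : differentiable (fun v => bil P v v) v.
  have dm : differentiable (fun v : 'rV[R]_n => v *m P *m v^T) v.
    apply: differentiable_mulmx; last exact: differentiable_trmx.
    by apply: differentiable_mulmx => //; exact: differentiable_cst.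
  exact: (differentiable_mxP _ _ _ _ _).1 dm 0 0.
have wA : A (`|w|^-1 *: w).
  by rewrite /A /= normrZ normfV normr_id mulVf ?normr_eq0.
have A0 v : A v -> v != 0.
  by move=> vA; rewrite -normr_eq0 vA oner_neq0.
have [|||c cA cmax] := @EVT_max_rV R n r A.
- by exists (`|w|^-1 *: w).
- apply: bounded_closed_compact.
    by exists 1; split => // M M1 v /= ->; exact: ltW.
  have -> : A = (fun v => `|v|) @^-1` [set 1] by [].
  apply: closed_comp; last exact: closed_eq.
  by move=> v _; exact: norm_continuous.
- apply: continuous_in_subspaceT => v; rewrite inE => vA.
  apply: differentiable_continuous; apply: differentiableM => //.
  by apply: differentiableV => //; rewrite gt_eqF // G0 // A0.
rewrite inE in cA; have c0 := A0 _ cA.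
have rS v : bil S v v <= r c * bil G v v.
  have [->|v0] := eqVneq v 0; first by rewrite !bil0l mulr0.
  have nv : 0 < `|v| by rewrite normr_gt0.
  have : r (`|v|^-1 *: v) <= r c.
    apply: cmax; rewrite inE /A /= normrZ normfV normr_id mulVf ?gt_eqF //.
  rewrite /r !(bilZl, bilZr) -/(r c) => h.
  have Gv := G0 _ v0.
  rewrite -ler_pdivrMr //; apply: le_trans h.
  rewrite le_eqVlt; apply/orP; left; apply/eqP; field.
  by rewrite !gt_eqF.
exists (r c), c; split => //.
(* No Lagrange multiplier is involved: [r c *: G - S] is positive semidefinite by maximality and its
   form vanishes at [c], so [c] is in its kernel. *)
have E : c *m (r c *: G - S) = 0.
  apply: psd_kernel => [|v|].
  - by rewrite linearB linearZ /= sG sS.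
  - by rewrite bilBmx bilZmx subr_ge0.
  - by rewrite bilBmx bilZmx /r divfK ?subrr // gt_eqF // G0.
by apply/esym/eqP; rewrite -subr_eq0 scalemxAr -mulmxBr E.
Qed.

(** Symmetry of [Q *m G] says that [u |-> u *m Q] is self-adjoint for [G]. The maximal Rayleigh
    quotient is one of its eigenvalues and bounds all of them, so the supremum in [lambda_max] is
    that of a nonempty bounded set. *)
Lemma lambda_max_ge (Q G : 'M[R]_n) (v : 'rV[R]_n) :
  posdef G -> (Q *m G)^T = Q *m G ->
  bil (Q *m G) v v <= lambda_max (fun u : 'rV[R]_n => u *m Q) * bil G v v.
Proof.
move=> pG sS; have [_ G0] := pG.
have [->|v0] := eqVneq v 0; first by rewrite !bil0l mulr0.
have [l [c [c0 cl lmax]]] := rayleigh_quotient_max _ _ _ pG sS v0.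
apply: le_trans (lmax v) _; rewrite ler_wpM2r ?posdef_ge0 //.
have cQ : c *m Q = l *: c.
  apply: (can_inj (mulmxK (posdef_unit _ pG))).
  by rewrite -mulmxA cl scalemxAl.
apply: sup_upper_bound; last by exists c.
split; first by exists l, c.
exists l => a [u u0 uQ].
have := lmax u; rewrite {1}/bil mulmxA uQ.
have -> : (a *: u *m G *m u^T) 0 0 = a * bil G u u by rewrite -bilZl.
by rewrite ler_pM2r // G0.
Qed.

End FormTheory.
End Forms.

(** * Charts and the metric *)

Section ManifoldFields.
Context {R : realType} {n : nat}.

Lemma dom_open (M : smoothManifold R n) (i : chart M) : open (dom i).
Proof. by case: M i. Qed.

Lemma img_open (M : smoothManifold R n) (i : chart M) : open (img i).
Proof. by case: M i. Qed.

Lemma phiK (M : smoothManifold R n) (i : chart M) (x : M) :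
  dom i x -> psi i (phi i x) = x.
Proof. by case: M i x => /=. Qed.

Lemma phi_continuous (M : smoothManifold R n) (i : chart M) (x : M) :
  dom i x -> {for x, continuous (phi i)}.
Proof. by case: M i x => /=. Qed.

Lemma psi_continuous (M : smoothManifold R n) (i : chart M) (y : 'rV[R]_n) :
  img i y -> {for y, continuous (psi i)}.
Proof. by case: M i y => /=. Qed.

Lemma transition_smooth (M : smoothManifold R n) (i j : chart M) :
  smooth (phi i @` (dom i `&` dom j)) (phi j \o psi i).
Proof. by case: M i j => /=. Qed.

Lemma dom_chart_at (M : smoothManifold R n) (x : M) : dom (chart_at x) x.
Proof. by case: M x => /=. Qed.

End ManifoldFields.

HB.lock Definition transition_jacobian (R : realType) (n : nat)
  (M : smoothManifold R n) (i j : chart M) (y : 'rV[R]_n) : 'M[R]_n :=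
  jacobian (phi j \o psi i) y.
Arguments transition_jacobian {R n M}.

Section Transition.
Context {R : realType} {n : nat} {M : smoothManifold R n}.
Implicit Types (i j c : chart M) (x : M) (y v w : 'rV[R]_n).

Definition overlap i j : set 'rV[R]_n := phi i @` (dom i `&` dom j).

Lemma img_phi i x : dom i x -> img i (phi i x).
Proof. by exists x. Qed.

Lemma psi_dom i y : img i y -> dom i (psi i y).
Proof. by move=> [x ix <-]; rewrite phiK. Qed.

Lemma psiK i y : img i y -> phi i (psi i y) = y.
Proof. by move=> [x ix <-]; rewrite phiK. Qed.

Lemma near_img i y : img i y -> \forall z \near y, img i z.
Proof. by move=> iy; apply: open_nbhs_nbhs; split => //; exact: img_open. Qed.

Lemma near_psi i y (A : set M) : img i y -> nbhs (psi i y) A ->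
  \forall z \near y, A (psi i z).
Proof. by move=> iy; exact: psi_continuous. Qed.

Lemma near_phi i x (B : set 'rV[R]_n) : dom i x -> nbhs (phi i x) B ->
  \forall z \near x, dom i z /\ B (phi i z).
Proof.
move=> ix xB; near=> z; split; near: z.
  by apply: open_nbhs_nbhs; split => //; exact: dom_open.
exact: phi_continuous.
Unshelve. all: by end_near. Qed.

Lemma overlapE i j y : overlap i j y <-> img i y /\ dom j (psi i y).
Proof.
split=> [[x [ix jx] <-]|[iy jy]].
  by split; [exact: img_phi|rewrite phiK].
by exists (psi i y); [split => //; exact: psi_dom|exact: psiK].
Qed.

Lemma overlap_phi i j x : dom i x -> dom j x -> overlap i j (phi i x).
Proof. by move=> ix jx; exists x. Qed.

Lemma near_overlap i j y : overlap i j y -> \forall z \near y, overlap i j z.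
Proof.
move=> /overlapE[iy jy].
have A1 := near_img _ _ iy.
have A2 : \forall z \near y, dom j (psi i z).
  by apply: near_psi => //; apply: open_nbhs_nbhs; split => //; exact: dom_open.
by apply: filterS2 A1 A2 => z iz jz; exact/overlapE.
Qed.

Lemma transition_diff i j y : overlap i j y ->
  differentiable (phi j \o psi i) y.
Proof. by move=> ijy; have [+ _] := transition_smooth M i j 1; apply. Qed.

Lemma derive_transition i j y v : overlap i j y ->
  'D_v (phi j \o psi i) y = v *m transition_jacobian i j y.
Proof.
move=> ijy; rewrite transition_jacobian.unlock deriveEjacobian //.
exact: transition_diff.
Qed.

Lemma transition_jacobian_id i y : img i y -> transition_jacobian i i y = 1%:M.
Proof.
move=> iy; apply/row_matrixP => a; rewrite !rowE mulmx1.
have iiy : overlap i i y by apply/overlapE; split => //; exact: psi_dom.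
rewrite -derive_transition // -[RHS](derive_id y (delta_mx 0 a)).
apply: near_eq_derive; apply: filterS (near_img _ _ iy) => z iz /=.
exact: psiK.
Qed.

Lemma transition_jacobian_comp i j c x : dom i x -> dom j x -> dom c x ->
  transition_jacobian i j (phi i x) *m transition_jacobian j c (phi j x) =
  transition_jacobian i c (phi i x).
Proof.
move=> ix jx cx; apply/row_matrixP => a; rewrite !rowE mulmxA.
have ijx := overlap_phi _ _ _ ix jx; have jcx := overlap_phi _ _ _ jx cx.
have icx := overlap_phi _ _ _ ix cx.
have jcx' : overlap j c ((phi j \o psi i) (phi i x)) by rewrite /= phiK.
rewrite -(derive_transition _ _ _ _ ijx) -(derive_transition _ _ _ _ icx).
rewrite -(derive_transition _ _ _ _ jcx).
rewrite -{1}(phiK _ i x ix) -[phi j (psi i _)]/((phi j \o psi i) (phi i x)).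
rewrite -derive_comp; [|exact: transition_diff|exact: transition_diff].
apply: near_eq_derive; apply: filterS (near_overlap _ _ _ ijx) => z /overlapE[iz jz].
by rewrite /= phiK.
Qed.

Lemma transition_jacobianV i j x : dom i x -> dom j x ->
  transition_jacobian i j (phi i x) *m transition_jacobian j i (phi j x) = 1%:M.
Proof.
move=> ix jx; rewrite transition_jacobian_comp // transition_jacobian_id //.
exact: img_phi.
Qed.

Lemma to_chartE i x v : dom i x ->
  to_chart i x v = v *m transition_jacobian (chart_at x) i (phi (chart_at x) x).
Proof.
move=> ix; apply: derive_transition; apply: overlap_phi => //.
exact: dom_chart_at.
Qed.

Lemma of_chartE i x w : dom i x ->
  of_chart i x w = w *m transition_jacobian i (chart_at x) (phi i x).
Proof.
move=> ix; apply: derive_transition; apply: overlap_phi => //.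
exact: dom_chart_at.
Qed.

Lemma to_chartK i x v : dom i x -> of_chart i x (to_chart i x v) = v.
Proof.
move=> ix; rewrite to_chartE // of_chartE // -mulmxA transition_jacobianV ?mulmx1 //.
exact: dom_chart_at.
Qed.

Lemma of_chartK i x v : dom i x -> to_chart i x (of_chart i x v) = v.
Proof.
move=> ix; rewrite to_chartE // of_chartE // -mulmxA transition_jacobianV ?mulmx1 //.
exact: dom_chart_at.
Qed.

Lemma to_chart_at x v : to_chart (chart_at x) x v = v.
Proof.
have cx := dom_chart_at M x.
by rewrite to_chartE // transition_jacobian_id ?mulmx1 //; exact: img_phi.
Qed.

End Transition.

Section Metric.
Context {R : realType} {n : nat} {M : smoothManifold R n}.
Context (g : riemannianMetric M).
Implicit Types (i j c : chart M) (x : M) (y v w : 'rV[R]_n).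

Lemma gram_posdef x : posdef (g x).
Proof. by case: g => G sG pG smG; split; [exact: sG|exact: pG]. Qed.

Lemma chart_gram_smooth i a b : smooth (img i) (fun y => chart_gram g i y a b).
Proof. by case: g. Qed.

Lemma chart_gramE i x : dom i x -> chart_gram g i (phi i x) =
  transition_jacobian i (chart_at x) (phi i x) *m g x *m
  (transition_jacobian i (chart_at x) (phi i x))^T.
Proof.
move=> ix; apply/matrixP => a b; rewrite mxE phiK // !of_chartE //.
set J := transition_jacobian _ _ _.
rewrite /in_product trmx_mul trmx_delta !mulmxA -(mulmxA (delta_mx 0 a)).
by rewrite -(mulmxA (delta_mx 0 a)) -rowE -colE !mxE.
Qed.

Lemma inner_chart i x u v : dom i x ->
  inner g x u v = bil (chart_gram g i (phi i x)) (to_chart i x u) (to_chart i x v).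
Proof.
move=> ix; rewrite chart_gramE // /bil /inner /in_product.
have cx := dom_chart_at M x.
rewrite !to_chartE // !trmx_mul !mulmxA.
have K w : w *m transition_jacobian (chart_at x) i (phi (chart_at x) x) *m
    transition_jacobian i (chart_at x) (phi i x) = w.
  by rewrite -mulmxA transition_jacobianV // mulmx1.
by rewrite K -!mulmxA -!trmx_mul !mulmxA K.
Qed.

Lemma chart_gram_posdef i y : img i y -> posdef (chart_gram g i y).
Proof.
move=> [x ix <-]; have [sG pG] := gram_posdef x; split.
  by rewrite chart_gramE // !trmx_mul trmxK sG !mulmxA.
move=> v v0; rewrite -(of_chartK _ _ v ix) -inner_chart //; apply: pG.
by apply: contraNneq v0 => ov; rewrite -(of_chartK _ _ v ix) ov to_chartE // mul0mx.
Qed.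

Lemma chart_gram_at x : chart_gram g (chart_at x) (phi (chart_at x) x) = g x.
Proof.
have cx := dom_chart_at M x.
by rewrite chart_gramE // transition_jacobian_id ?trmx1 ?mulmx1 ?mul1mx //; exact: img_phi.
Qed.

Lemma chart_gram_diff i y : img i y -> differentiable (chart_gram g i) y.
Proof.
move=> iy; apply/differentiable_mxP => a b.
by have [+ _] := chart_gram_smooth i a b 1; apply.
Qed.

Lemma chart_gram_unit i y : img i y -> chart_gram g i y \in unitmx.
Proof. by move=> iy; apply: posdef_unit; exact: chart_gram_posdef. Qed.

Lemma chart_gram_inv_diff i y : img i y ->
  differentiable (fun y => invmx (chart_gram g i y)) y.
Proof.
move=> iy; apply: differentiable_invmx; first exact: chart_gram_diff.
by apply: filterS (near_img _ _ iy) => z iz; exact: chart_gram_unit.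
Qed.

End Metric.

(** * Gradient and Hessian in charts *)

HB.lock Definition coord_diff (R : realType) (n : nat) (M : smoothManifold R n)
  (f : M -> R) (i : chart M) (y : 'rV[R]_n) : 'rV[R]_n :=
  \row_a 'D_(delta_mx 0 a) (f \o psi i) y.
Arguments coord_diff {R n M}.

(** The gradient field in the coordinates of [i]: the differential with its index raised by the
    inverse metric. The chart stays fixed while the point moves, so this field can be
    differentiated. *)
HB.lock Definition coord_grad (R : realType) (n : nat) (M : smoothManifold R n)
  (g : riemannianMetric M) (f : M -> R) (i : chart M) (y : 'rV[R]_n) : 'rV[R]_n :=
  coord_diff f i y *m invmx (chart_gram g i y).
Arguments coord_grad {R n M}.

(** With [X] in all three slots, renaming indices makes the three sums in the Christoffel symbols
    equal; two of them cancel. *)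
Lemma christoffel_sum (R : numFieldType) (n : nat) (X : 'I_n -> R)
  (d : 'I_n -> 'I_n -> 'I_n -> R) :
  \sum_l X l * \sum_a \sum_b X a * X b * (2^-1 * (d a b l + d b a l - d l a b)) =
  2^-1 * \sum_b \sum_l X b * (\sum_a X a * d a b l) * X l.
Proof.
pose t (e : 'I_n -> 'I_n -> 'I_n -> R) :=
  \sum_l \sum_a \sum_b X l * X a * X b * e a b l.
have -> : \sum_l X l * \sum_a \sum_b
    X a * X b * (2^-1 * (d a b l + d b a l - d l a b)) =
    2^-1 * (t d + t (fun a b l => d b a l) - t (fun a b l => d l a b)).
  rewrite /t -sumrN -!big_split mulr_sumr; apply: eq_bigr => l _.
  rewrite -sumrN -!big_split !mulr_sumr; apply: eq_bigr => a _.
  rewrite -sumrN -!big_split !mulr_sumr; apply: eq_bigr => b _ /=; ring.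
have -> : t (fun a b l => d b a l) = t d.
  apply: eq_bigr => l _; rewrite exchange_big; apply: eq_bigr => a _.
  by apply: eq_bigr => b _ /=; ring.
have -> : t (fun a b l => d l a b) = t d.
  rewrite [RHS]/t [RHS]exchange_big; apply: eq_bigr => a _.
  rewrite [RHS]exchange_big; apply: eq_bigr => b _.
  by apply: eq_bigr => l _ /=; ring.
rewrite addrK; congr (_ * _).
rewrite /t [RHS]exchange_big; apply: eq_bigr => l _ /=.
rewrite exchange_big; apply: eq_bigr => b _ /=.
by rewrite mulr_sumr mulr_suml; apply: eq_bigr => a _; ring.
Qed.

Section Gradient.
Context {R : realType} {n : nat} {M : smoothManifold R n}.
Context (g : riemannianMetric M) (f : M -> R) (hf : Ck_fun 2 f).
Implicit Types (i j c : chart M) (x : M) (y v w : 'rV[R]_n).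
Local Notation p := (coord_diff f).
Local Notation X := (coord_grad g f).
Local Notation G := (chart_gram g).

Lemma coord_fun_diff i y : img i y -> differentiable (f \o psi i) y.
Proof. by move=> iy; have [+ _] := hf i; apply. Qed.

Lemma derive_coord_fun i y v : img i y ->
  'D_v (f \o psi i) y = (v *m (p i y)^T) 0 0.
Proof.
move=> iy; rewrite derive_rVE; last exact: coord_fun_diff.
by rewrite mxE; apply: eq_bigr => a _; rewrite coord_diff.unlock !mxE.
Qed.

Lemma coord_diff_diff i y : img i y -> differentiable (p i) y.
Proof.
move=> iy; apply/differentiable_mxP => k a; rewrite ord1.
have -> : (fun y => p i y 0 a) = 'D_(delta_mx 0 a) (f \o psi i).
  by apply/funext => z; rewrite coord_diff.unlock mxE.
by have [_ /(_ (delta_mx 0 a))[+ _]] := hf i; apply.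
Qed.

(** Chain rule: the differential is a covector, hence the transposed Jacobian. *)
Lemma coord_diff_change i j x : dom i x -> dom j x ->
  p i (phi i x) = p j (phi j x) *m (transition_jacobian i j (phi i x))^T.
Proof.
move=> ix jx; have ijx := overlap_phi _ _ _ ix jx.
apply/rowP => a; rewrite {1}coord_diff.unlock mxE.
have -> : 'D_(delta_mx 0 a) (f \o psi i) (phi i x) =
    'D_(delta_mx 0 a) ((f \o psi j) \o (phi j \o psi i)) (phi i x).
  apply: near_eq_derive; apply: filterS (near_overlap _ _ _ ijx) => z.
  by move=> /overlapE[iz jz]; rewrite /= phiK.
have E : (phi j \o psi i) (phi i x) = phi j x by rewrite /= phiK.
rewrite derive_comp; [|exact: transition_diff|].
  rewrite E derive_transition // derive_coord_fun; last exact: img_phi.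
  rewrite -rowE !mxE; apply: eq_bigr => b _; rewrite !mxE; exact: mulrC.
by rewrite E; apply: coord_fun_diff; exact: img_phi.
Qed.

Lemma grad_coord_diff x :
  grad g f x = p (chart_at x) (phi (chart_at x) x) *m invmx (g x).
Proof. by rewrite /grad coord_diff.unlock. Qed.

Lemma coord_gradM i y : img i y -> X i y *m G i y = p i y.
Proof.
by move=> iy; rewrite coord_grad.unlock mulmxKV //; exact: chart_gram_unit.
Qed.

(** The Jacobians in the change of the differential and of the Gram matrix cancel. This lets one
    chart [i] replace the preferred charts of all points of its domain. *)
Lemma to_chart_grad i x : dom i x -> to_chart i x (grad g f x) = X i (phi i x).
Proof.
move=> ix; have cx := dom_chart_at M x.
have uG := chart_gram_unit g _ _ (img_phi _ _ ix).
apply: (can_inj (mulmxK uG)); rewrite coord_gradM; last exact: img_phi.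
have ug : g x \in unitmx by apply: posdef_unit; exact: gram_posdef.
rewrite to_chartE // grad_coord_diff (coord_diff_change _ _ _ cx ix).
rewrite chart_gramE //.
set J := transition_jacobian (chart_at x) i _.
set J' := transition_jacobian i _ _.
have JJ' : J *m J' = 1%:M by exact: transition_jacobianV.
have J'J : J' *m J = 1%:M by exact: transition_jacobianV.
rewrite !mulmxA -(mulmxA _ J J') JJ' mulmx1 (mulmxKV ug).
by rewrite -mulmxA -trmx_mul J'J trmx1 mulmx1.
Qed.

Lemma coord_grad_diff i y : img i y -> differentiable (X i) y.
Proof.
move=> iy; rewrite coord_grad.unlock; apply: differentiable_mulmx.
  exact: coord_diff_diff.
exact: chart_gram_inv_diff.
Qed.

Definition sqgrad i y : R := (X i y *m (p i y)^T) 0 0.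

Lemma sqgradE i y : img i y -> sqgrad i y = bil (G i y) (X i y) (X i y).
Proof.
move=> iy; have [sG _] := chart_gram_posdef g _ _ iy.
by rewrite /sqgrad /bil -mulmxA -[in RHS](trmxK (G i y)) sG -trmx_mul coord_gradM.
Qed.

Lemma inner_grad i x : dom i x ->
  inner g x (grad g f x) (grad g f x) = sqgrad i (phi i x).
Proof.
move=> ix; rewrite (inner_chart g i) // to_chart_grad // sqgradE //.
exact: img_phi.
Qed.

Lemma sqgrad_diff i y : img i y -> differentiable (sqgrad i) y.
Proof.
move=> iy; have : differentiable (fun y => X i y *m (p i y)^T) y.
  apply: differentiable_mulmx; first exact: coord_grad_diff.
  by apply: differentiable_trmx; exact: coord_diff_diff.
by move=> /differentiable_mxP; apply.
Qed.

Lemma derive_coord_diff i y v : img i y ->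
  'D_v (p i) y = 'D_v (X i) y *m G i y + X i y *m 'D_v (G i) y.
Proof.
move=> iy; rewrite -derive_mulmx; [|exact: coord_grad_diff|exact: chart_gram_diff].
apply: near_eq_derive; apply: filterS (near_img _ _ iy) => z iz.
by rewrite coord_gradM.
Qed.

(** Differentiating [X *m G = p] expresses ['D_v X *m G] by the derivatives of [p] and [G], so the
    inverse metric is never differentiated explicitly. *)
Lemma derive_sqgrad i y v : img i y -> 'D_v (sqgrad i) y =
  2 * ('D_v (p i) y *m (X i y)^T) 0 0 - bil ('D_v (G i) y) (X i y) (X i y).
Proof.
move=> iy; have [sG _] := chart_gram_posdef g _ _ iy.
have dX := coord_grad_diff _ _ iy; have dp := coord_diff_diff _ _ iy.
have -> : 'D_v (sqgrad i) y = ('D_v (fun y => X i y *m (p i y)^T) y) 0 0.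
  by rewrite derive_coord //; apply: differentiable_mulmx => //; exact: differentiable_trmx.
rewrite derive_mulmx //; last exact: differentiable_trmx.
rewrite derive_trmx // -{1}(coord_gradM _ _ iy) trmx_mul sG mulmxA.
have -> : 'D_v (X i) y *m G i y = 'D_v (p i) y - X i y *m 'D_v (G i) y.
  by rewrite derive_coord_diff // addrK.
have -> : X i y *m ('D_v (p i) y)^T = ('D_v (p i) y *m (X i y)^T)^T.
  by rewrite trmx_mul trmxK.
by rewrite mulmxBl /bil !mxE; ring.
Qed.

(** The squared gradient norm is a function on the manifold, so its derivative changes by the
    Jacobian alone. This replaces the transformation law of the Christoffel symbols, with its second
    derivatives of transition maps. *)
Lemma derive_sqgrad_change i j x v : dom i x -> dom j x ->
  'D_v (sqgrad i) (phi i x) =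
  'D_(v *m transition_jacobian i j (phi i x)) (sqgrad j) (phi j x).
Proof.
move=> ix jx; have ijx := overlap_phi _ _ _ ix jx.
have E : (phi j \o psi i) (phi i x) = phi j x by rewrite /= phiK.
have -> : 'D_v (sqgrad i) (phi i x) = 'D_v (sqgrad j \o (phi j \o psi i)) (phi i x).
  apply: near_eq_derive; apply: filterS (near_overlap _ _ _ ijx) => z.
  move=> /overlapE[iz jz]; have iz' := psi_dom _ _ iz.
  by rewrite /= -(inner_grad _ _ jz) (inner_grad i _ iz') psiK.
rewrite derive_comp; [|exact: transition_diff|].
  by rewrite E derive_transition.
by rewrite E; apply: sqgrad_diff; exact: img_phi.
Qed.

Definition christoffel_term i y v w : 'rV[R]_n :=
  \row_k \sum_(a < n) \sum_(b < n) v 0 a * w 0 b * christoffel g i y k a b.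

Lemma hessE x v : let c := chart_at x in let y := phi c x in
  hess g f x v = 'D_v (X c) y + christoffel_term c y v (X c y).
Proof.
move=> c y; have cx := dom_chart_at M x.
have iy : img c y by exact: img_phi.
have near_X : \forall z \near y,
    to_chart c (psi c z) (grad g f (psi c z)) = X c z.
  apply: filterS (near_img _ _ iy) => z iz.
  by rewrite to_chart_grad ?psiK //; exact: psi_dom.
rewrite /hess /nabla /= -/c -/y (near_eq_derive _ near_X).
by rewrite (nbhs_singleton near_X).
Qed.

Lemma christoffel_term_bil i y : img i y ->
  bil (G i y) (X i y) (christoffel_term i y (X i y) (X i y)) =
  2^-1 * bil ('D_(X i y) (G i) y) (X i y) (X i y).
Proof.
move=> iy; set Y := X i y.
pose d (a b l : 'I_n) := 'D_(delta_mx 0 a) (fun z => G i z b l) y.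
(* [u] is the contraction of the Christoffel symbols of the first kind; the inverse metric factored
   out here cancels against [G]. *)
pose u : 'rV[R]_n := \row_l \sum_a \sum_b
  Y 0 a * Y 0 b * (2^-1 * (d a b l + d b a l - d l a b)).
have -> : christoffel_term i y Y Y = u *m (invmx (G i y))^T.
  apply/rowP => k; rewrite !mxE.
  under [RHS]eq_bigr do rewrite !mxE mulr_suml.
  rewrite [RHS]exchange_big /=; apply: eq_bigr => a _.
  under [RHS]eq_bigr do rewrite mulr_suml.
  rewrite [RHS]exchange_big /=; apply: eq_bigr => b _.
  rewrite /christoffel !mulr_sumr; apply: eq_bigr => l _; rewrite /d; ring.
rewrite {1}/bil trmx_mul trmxK !mulmxA mulmxK; last exact: chart_gram_unit.
rewrite mxE; under eq_bigr do rewrite !mxE.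
rewrite christoffel_sum bilE; congr (_ * _); apply: eq_bigr => b _.
apply: eq_bigr => l _; congr (_ * _ * _).
rewrite derive_coord; last exact: chart_gram_diff.
rewrite derive_rVE //.
by have := chart_gram_diff g _ _ iy; move=> /differentiable_mxP; apply.
Qed.

Lemma grad_to_chart_at x : let c := chart_at x in grad g f x = X c (phi c x).
Proof.
by rewrite /= -to_chart_grad ?to_chart_at //; exact: dom_chart_at.
Qed.

(* Metric compatibility: <grad f, Hess f (grad f)> is half the derivative of
   |grad f|^2 along grad f, which only involves first-order changes of chart. *)
Lemma inner_grad_hess i x : dom i x -> let y := phi i x in
  inner g x (grad g f x) (hess g f x (grad g f x)) =
  ('D_(X i y) (p i) y *m (X i y)^T) 0 0
    - 2^-1 * bil ('D_(X i y) (G i) y) (X i y) (X i y).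
Proof.
move=> ix /=; have cx := dom_chart_at M x; set c := chart_at x in cx *.
have cy := img_phi _ _ cx; have iy := img_phi _ _ ix.
suff -> : inner g x (grad g f x) (hess g f x (grad g f x)) =
    2^-1 * 'D_(X c (phi c x)) (sqgrad c) (phi c x).
  rewrite (derive_sqgrad_change _ _ _ _ cx ix) -grad_to_chart_at -to_chartE //.
  rewrite to_chart_grad // derive_sqgrad // mulrBr mulrA mulVf ?mul1r //.
rewrite hessE -/c (grad_to_chart_at x) -/c derive_sqgrad //.
set y := phi c x; set Y := X c y.
have [sG _] := chart_gram_posdef g _ _ cy.
rewrite /inner /in_product -chart_gram_at -/c -/y -/(bil _ _ _).
rewrite bilDr christoffel_term_bil // -/Y derive_coord_diff //.
have -> : bil (G c y) Y ('D_Y (X c) y) = ('D_Y (X c) y *m G c y *m Y^T) 0 0.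
  by rewrite bilC.
by rewrite mulmxDl [X in 2 * X]mxE /bil -/Y; field.
Qed.

Lemma hess_linear x : linear (hess g f x).
Proof.
have cx := dom_chart_at M x; have cy := img_phi _ _ cx.
move=> a u v; rewrite !hessE.
have dX := coord_grad_diff _ _ cy.
rewrite !(deriveE _ dX) linearP scalerDr -!addrA; congr (_ + _).
rewrite addrCA; congr (_ + _); apply/rowP => k; rewrite !mxE.
rewrite mulr_sumr -big_split; apply: eq_bigr => b _.
rewrite mulr_sumr -big_split; apply: eq_bigr => l _.
by rewrite !mxE /=; ring.
Qed.

End Gradient.

(** * Estimates near a point *)

Lemma continuous_mx (R : realType) (T : topologicalType) (m n : nat)
  (A : T -> 'M[R]_(m, n)) (x : T) :
  (forall i j, {for x, continuous (fun y => A y i j)}) -> {for x, continuous A}.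
Proof.
move=> cA; apply/cvgrPdist_le => /= e e0.
have : \forall y \near x, forall k : 'I_m * 'I_n,
    `|A x k.1 k.2 - A y k.1 k.2| <= e.
  apply: filter_forall => k.
  by have /cvgrPdist_le/(_ e e0) := cA k.1 k.2.
apply: filterS => y h; apply: mx_norm_le; first exact: ltW.
by move=> i j; rewrite !mxE; exact: (h (i, j)).
Qed.

Lemma near_eq_continuous (T U : topologicalType) (u v : T -> U) (x : T) :
  (\forall y \near x, u y = v y) -> {for x, continuous u} -> {for x, continuous v}.
Proof.
move=> E c; have ux := nbhs_singleton E.
have : u @ x --> v x by rewrite -ux.
by apply: cvg_trans; apply: near_eq_cvg; apply: filterS E => y ->.
Qed.

Lemma near_dist_le (R : realType) (T : topologicalType) (V : normedModType R)
  (h : T -> V) (x : T) (e : R) : {for x, continuous h} -> 0 < e ->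
  \forall y \near x, `|h y - h x| <= e.
Proof.
move=> ch e0; have /cvgrPdist_le/(_ e e0) := ch.
by apply: filterS => y; rewrite distrC.
Qed.

Lemma near_forall_fin (T : topologicalType) (I : finType) (x : T)
  (P : I -> T -> Prop) :
  (forall i, \forall y \near x, P i y) -> \forall y \near x, forall i, P i y.
Proof. by move=> h; apply: filter_forall. Qed.

Lemma sum_error_le (R : realFieldType) (a b c e s u q t : R) :
  a <= b + q -> b <= c -> c <= s + u * q -> - e <= t * q ->
  a - e <= s + (1 + u + t) * q.
Proof. move=> *; lra. Qed.

Section LocalEstimates.
Context {R : realType} {n : nat} {M : smoothManifold R n}.
Context (g : riemannianMetric M).
Implicit Types (i j c : chart M) (x : M) (y v w : 'rV[R]_n).
Local Notation G := (chart_gram g).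

Lemma tnorm_ge0 x v : 0 <= tnorm g x v.
Proof. exact: sqrtr_ge0. Qed.

Lemma inner_posdef_ge0 x v : 0 <= inner g x v v.
Proof. by apply: posdef_ge0; exact: gram_posdef. Qed.

Lemma tnorm_sqr x v : tnorm g x v ^+ 2 = inner g x v v.
Proof. by rewrite sqr_sqrtr // inner_posdef_ge0. Qed.

Lemma tnorm_eq0 x v : tnorm g x v = 0 -> v = 0.
Proof.
move=> v0; have [_ pG] := gram_posdef g x.
apply/eqP/contraT => /pG; rewrite -[bil _ v v]/(inner g x v v) -tnorm_sqr v0.
by rewrite expr0n ltxx.
Qed.

Lemma tnormZ x a v : tnorm g x (a *: v) = `|a| * tnorm g x v.
Proof.
rewrite /tnorm -[inner g x (a *: v) _]/(bil (g x) (a *: v) (a *: v)) bilZl bilZr.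
by rewrite mulrA -expr2 sqrtrM ?sqr_ge0 // sqrtr_sqr.
Qed.

Lemma inner_le_tnorm x u v : `|inner g x u v| <= tnorm g x u * tnorm g x v.
Proof.
rewrite -ler_sqr ?nnegrE ?mulr_ge0 ?tnorm_ge0 // exprMn !tnorm_sqr.
by rewrite -normrX ger0_norm ?sqr_ge0 //; apply: posdef_CS; exact: gram_posdef.
Qed.

(** One constant serves a whole neighborhood: [posdef_coord] bounds coordinates through the inverse
    Gram matrix, [bil_le] bounds the form through the Gram matrix, and near [y0] both matrices
    exceed their norms at [y0] by at most 1. *)
Lemma near_norm_equiv i y0 : img i y0 ->
  exists2 K : R, 0 < K & \forall y \near y0, img i y /\ forall v,
    `|v| ^+ 2 <= K * bil (G i y) v v /\ bil (G i y) v v <= K * `|v| ^+ 2.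
Proof.
move=> iy0; pose K := `|invmx (G i y0)| + 1 + n%:R ^+ 2 * (`|G i y0| + 1).
have K1 : 0 < `|invmx (G i y0)| + 1 by rewrite ltr_wpDl.
have K2 : 0 <= n%:R ^+ 2 * (`|G i y0| + 1) by rewrite mulr_ge0 ?exprn_ge0 ?addr_ge0.
exists K; first by rewrite ltr_wpDr.
have cG : {for y0, continuous (G i)}.
  by apply: differentiable_continuous; exact: chart_gram_diff.
have cI : {for y0, continuous (fun y => invmx (G i y))}.
  by apply: differentiable_continuous; exact: chart_gram_inv_diff.
have N1 := near_dist_le _ _ _ _ _ _ cG ltr01.
have N2 := near_dist_le _ _ _ _ _ _ cI ltr01.
apply: filterS3 (near_img _ _ iy0) N1 N2 => y iy y1 y2; split => // v.
have pG := chart_gram_posdef g _ _ iy.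
have b0 := posdef_ge0 _ v pG.
have bound (m : nat) (A B : 'M[R]_m) : `|A - B| <= 1 -> `|A| <= `|B| + 1.
  by move=> AB; rewrite -lerBlDl (le_trans _ AB) // lerB_dist.
split.
  have : `|v| <= Num.sqrt (K * bil (G i y) v v).
    apply: mx_norm_le; first exact: sqrtr_ge0.
    move=> k a; rewrite ord1 -sqrtr_sqr ler_wsqrtr //.
    apply: le_trans (posdef_coord _ v a pG) _; rewrite ler_wpM2r //.
    apply: le_trans (ler_norm _) _; apply: le_trans (mx_coord_le _ _ _ _ _) _.
    by apply: le_trans (bound _ _ _ y2) _; rewrite lerDl.
  rewrite -ler_sqr ?nnegrE ?sqrtr_ge0 // sqr_sqrtr // mulr_ge0 //.
  by rewrite ltW // ltr_wpDr.
apply: le_trans (ler_norm _) _; apply: le_trans (bil_le _ _ _) _.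
rewrite -expr2 ler_wpM2r ?exprn_ge0 // (@le_trans _ _ (n%:R ^+ 2 * (`|G i y0| + 1))) //.
  by rewrite ler_wpM2l ?exprn_ge0 //; exact: bound.
by rewrite lerDr ltW.
Qed.

Section Curvature.
Context (f : M -> R) (hf : Ck_fun 2 f).
Local Notation p := (coord_diff f).
Local Notation X := (coord_grad g f).

(** Fermat's rule along each coordinate line through [phi i x]. *)
Lemma local_min_coord_diff i x : dom i x -> local_min f x -> p i (phi i x) = 0.
Proof.
move=> ix fx; have iy := img_phi _ _ ix; set y := phi i x in iy *.
apply/rowP => a; rewrite coord_diff.unlock !mxE.
set v := delta_mx 0 a.
pose u (t : R) := y + t *: v.
have du t : differentiable u t by exact: differentiable_line.
have Du t : 'D_1 u t = v by exact: derive_line.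
have u0 : u 0 = y by rewrite /u scale0r addr0.
have N0 : \forall z \near y, img i z /\ f x <= f (psi i z).
  have N1 : \forall z \near y, f x <= f (psi i z).
    by apply: (near_psi i y [set z | f x <= f z] iy); rewrite /y phiK.
  by apply: filterS2 (near_img _ _ iy) N1 => z; split.
have N1 : \forall t \near (0 : R), img i (u t) /\ f x <= f (psi i (u t)).
  have cu : {for 0, continuous u} by exact: differentiable_continuous.
  by apply: (cu [set z | img i z /\ f x <= f (psi i z)]); rewrite u0.
have [r r0 rB] := near_norm_ball _ _ _ N1.
have rI t : t \in `]-r, r[ -> img i (u t) /\ f x <= f (psi i (u t)).
  rewrite in_itv /= => tr; apply: rB; by rewrite subr0 ltr_norml.
have z0 : (0 : R) \in `]-r, r[ by rewrite in_itv /= r0 oppr_lt0 r0.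
have dh t : t \in `]-r, r[ -> differentiable ((f \o psi i) \o u) t.
  move=> /rI[iu _]; apply: differentiable_comp => //.
  exact: coord_fun_diff.
have [_] : is_derive (0 : R) 1 ((f \o psi i) \o u) 0.
  apply: (@derive1_at_min R _ (-r) r 0).
  - by rewrite ltW // gtrN.
  - by move=> t tr; apply/derivable1_diffP; exact: dh.
  - exact: z0.
  - by move=> t /rI[_]; rewrite /= u0 /y phiK.
rewrite derive_comp ?Du ?u0 //; exact: coord_fun_diff.
Qed.

Lemma local_min_grad x : local_min f x -> grad g f x = 0.
Proof.
move=> fx; rewrite (grad_coord_diff g f).
by rewrite local_min_coord_diff ?mul0mx //; exact: dom_chart_at.
Qed.

Lemma near_tnorm_grad x0 (e : R) : grad g f x0 = 0 -> 0 < e ->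
  \forall x \near x0, tnorm g x (grad g f x) < e.
Proof.
move=> gx0 e0; pose i := chart_at x0; have ix := dom_chart_at M x0.
have iy := img_phi _ _ ix.
have c : {for phi i x0, continuous (sqgrad g f i)}.
  by apply: differentiable_continuous; exact: sqgrad_diff.
have s0 : sqgrad g f i (phi i x0) = 0.
  by rewrite -inner_grad // gx0 -[inner _ _ _ _]/(bil _ _ _) bil0l.
have e2 : 0 < e ^+ 2 / 2 by rewrite divr_gt0 ?exprn_gt0.
have := near_phi _ _ _ ix (near_dist_le _ _ _ _ _ _ c e2).
apply: filterS => x [ix' ]; rewrite s0 subr0 -inner_grad // => hx.
rewrite -(ltr_pXn2r (n := 2)) ?nnegrE ?tnorm_ge0 ?ltW // tnorm_sqr.
apply: le_lt_trans (ler_norm _) _; apply: le_lt_trans hx _.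
by rewrite ltr_pdivrMr // ltr_pMr ?ltr1n // exprn_gt0.
Qed.

Definition coord_hess i y : 'M[R]_n :=
  \matrix_(a, b) 'D_(delta_mx 0 a) ('D_(delta_mx 0 b) (f \o psi i)) y.

Lemma derive_coord_diffE i y v : img i y -> 'D_v (p i) y = v *m coord_hess i y.
Proof.
move=> iy; have dp := coord_diff_diff _ hf _ _ iy.
rewrite derive_rVE // mulmx_sum_row; apply: eq_bigr => a _; congr (_ *: _).
apply/rowP => b; rewrite derive_coord // !mxE.
have -> // : (fun z => p i z 0 b) = 'D_(delta_mx 0 b) (f \o psi i).
by apply/funext => z; rewrite coord_diff.unlock mxE.
Qed.

Lemma coord_hess_sym i y : img i y -> (coord_hess i y)^T = coord_hess i y.
Proof.
move=> iy; apply/matrixP => a b; rewrite !mxE.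
exact: (Ck2_symmetric _ _ _ _ _ _ (img_open M i) (hf i)).
Qed.

Lemma coord_hess_continuous i y : img i y -> {for y, continuous (coord_hess i)}.
Proof.
move=> iy; apply: continuous_mx => a b.
have -> : (fun z => coord_hess i z a b) =
    'D_(delta_mx 0 a) ('D_(delta_mx 0 b) (f \o psi i)).
  by apply/funext => z; rewrite mxE.
have [_ /(_ (delta_mx 0 b))[_ /(_ (delta_mx 0 a))]] := hf i; exact.
Qed.

Lemma derive_chart_gram_continuous i y v : img i y ->
  {for y, continuous ('D_v (G i))}.
Proof.
move=> iy; apply: continuous_mx => a b.
have [_ /(_ v y iy) c] := chart_gram_smooth g i a b 1.
have E : \forall z \near y, 'D_v (fun z => G i z a b) z = ('D_v (G i) z) a b.
  apply: filterS (near_img _ _ iy) => z iz.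
  by rewrite derive_coord //; exact: chart_gram_diff.
exact: near_eq_continuous E c.
Qed.

Lemma near_derive_chart_gram_le i y : img i y -> \forall z \near y,
  forall a : 'I_n,
  `|'D_(delta_mx 0 a) (G i) z| <= `|'D_(delta_mx 0 a) (G i) y| + 1.
Proof.
move=> iy.
apply: (@near_forall_fin _ 'I_n y (fun a z =>
  `|'D_(delta_mx 0 a) (G i) z| <= `|'D_(delta_mx 0 a) (G i) y| + 1)) => a.
have c := derive_chart_gram_continuous i y (delta_mx 0 a) iy.
apply: filterS (near_dist_le _ _ _ _ _ _ c ltr01) => z hz.
by rewrite -lerBlDl (le_trans _ hz) // lerB_dist.
Qed.

(** Every term that contains the undifferentiated gradient vanishes, the Christoffel term included.
    What remains is the matrix of second partial derivatives with an index raised, whose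
    self-adjointness is Schwarz's theorem. *)
Lemma critical_hess x : grad g f x = 0 -> let c := chart_at x in
  hess g f x = fun v => v *m (coord_hess c (phi c x) *m invmx (g x)).
Proof.
move=> gx c; apply/funext => v; have cx := dom_chart_at M x.
have iy := img_phi _ _ cx.
have X0 : X c (phi c x) = 0 by rewrite -grad_to_chart_at.
rewrite hessE // -/c X0.
have -> : christoffel_term g c (phi c x) v 0 = 0.
  apply/rowP => k; rewrite !mxE big1 // => a _; rewrite big1 // => b _.
  by rewrite mxE mulr0 mul0r.
rewrite addr0 mulmxA -derive_coord_diffE //.
rewrite (derive_coord_diff g) // -/c X0 mul0mx addr0 -chart_gram_at mulmxK //.
exact: chart_gram_unit.
Qed.

(** At [x0] the bound is the Rayleigh inequality for [coord_hess]; near [x0] the matrices vary by at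
    most [d], and the resulting error is absorbed in [e]. *)
Lemma near_hess_le x0 (e : R) : grad g f x0 = 0 -> 0 < e ->
  \forall x \near x0,
    inner g x (grad g f x) (hess g f x (grad g f x)) <=
    (lambda_max (hess g f x0) + e) * inner g x (grad g f x) (grad g f x).
Proof.
move=> gx0 e0; pose i := chart_at x0; have ix0 := dom_chart_at M x0.
have iy0 := img_phi _ _ ix0; set y0 := phi i x0 in iy0.
set l := lambda_max _.
have X0 : X i y0 = 0 by rewrite -grad_to_chart_at.
have hl v : bil (coord_hess i y0) v v <= l * bil (G i y0) v v.
  have pG := chart_gram_posdef g _ _ iy0.
  rewrite /l (critical_hess _ gx0) -/i -/y0 -chart_gram_at -/i -/y0.
  have := @lambda_max_ge R n (coord_hess i y0 *m invmx (G i y0)) (G i y0) v pG.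
  rewrite mulmxKV ?chart_gram_unit // coord_hess_sym // => h; exact: h.
have [K K0 NK] := near_norm_equiv _ _ iy0.
pose T := \sum_a (`|'D_(delta_mx 0 a) (G i) y0| + 1).
have T0 : 0 <= T by apply: sumr_ge0 => a _; rewrite addr_ge0.
(* The three summands stand for the variation of [coord_hess], for that of the metric multiplied by
   [l], and for the derivative of the metric. The factor [n%:R ^+ 2] comes from [bil_le], and [K]
   converts the coordinate norm into the metric one. *)
pose C := n%:R ^+ 2 * (1 + `|l| + T) * K.
have C0 : 0 <= C by rewrite !mulr_ge0 ?exprn_ge0 ?addr_ge0 // ltW.
have C1 : 0 < C + 1 by rewrite ltr_wpDl.
have [d d0 dC] : exists2 d, 0 < d & d * C <= e.
  exists (e / (C + 1)); first exact: divr_gt0.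
  by rewrite mulrAC ler_pdivrMr // ler_pM2l // lerDl.
have NJ := near_dist_le _ _ _ _ _ _ (coord_hess_continuous _ _ iy0) d0.
have NG : \forall y \near y0, `|G i y - G i y0| <= d.
  apply: near_dist_le => //; apply: differentiable_continuous.
  exact: chart_gram_diff.
have NX : \forall y \near y0, `|X i y - X i y0| <= d.
  apply: near_dist_le => //; apply: differentiable_continuous.
  exact: coord_grad_diff.
have NT : \forall y \near y0, forall a : 'I_n,
    `|'D_(delta_mx 0 a) (G i) y| <= `|'D_(delta_mx 0 a) (G i) y0| + 1.
  exact: near_derive_chart_gram_le.
have N : \forall y \near y0, [/\ img i y,
    forall v, `|v| ^+ 2 <= K * bil (G i y) v v,
    `|coord_hess i y - coord_hess i y0| <= d /\ `|G i y - G i y0| <= d,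
    `|X i y| <= d & forall a : 'I_n,
    `|'D_(delta_mx 0 a) (G i) y| <= `|'D_(delta_mx 0 a) (G i) y0| + 1].
  move: NX; rewrite X0 => NX.
  apply: filterS (filterI NK (filterI NJ (filterI NG (filterI NX NT)))).
  move=> y [[iy Ky] [Jy [Gy [Xy Ty]]]]; split.
  - exact: iy.
  - by move=> v; have [] := Ky v.
  - exact: conj Jy Gy.
  - by rewrite -[X i y]subr0.
  - exact: Ty.
have := near_phi _ _ _ ix0 N.
apply: filterS => x [ix [iy Ky [Jy Gy] Xy Ty]].
rewrite (inner_grad_hess _ _ hf _ _ ix) (inner_grad g f hf i _ ix).
rewrite sqgradE //.
set y := phi i x in iy Ky Jy Gy Xy Ty *; set Y := X i y in Xy *.
set S := bil (G i y) Y Y.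
rewrite derive_coord_diffE // -/(bil _ _ _).
pose q := n%:R ^+ 2 * (`|Y| * `|Y|).
have q0 : 0 <= q by rewrite !mulr_ge0 ?exprn_ge0.
have nb (A B : 'M[R]_n) : `|A - B| <= d -> `|bil A Y Y - bil B Y Y| <= d * q.
  move=> AB; rewrite -bilBmx (le_trans (bil_le _ _ _)) //.
  have -> : d * q = n%:R ^+ 2 * d * (`|Y| * `|Y|) by rewrite /q; ring.
  by rewrite ler_wpM2r ?mulr_ge0 // ler_wpM2l ?exprn_ge0.
have J1 : bil (coord_hess i y) Y Y <= bil (coord_hess i y0) Y Y + d * q.
  by rewrite -lerBlDl (le_trans (ler_norm _)) // nb.
have G1 : l * bil (G i y0) Y Y <= l * S + `|l| * (d * q).
  rewrite -lerBlDl -mulrBr (le_trans (ler_norm _)) // normrM ler_wpM2l //.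
  by rewrite distrC nb.
(* This term is cubic in the gradient [Y], so [|Y| <= d] makes it as small as the other two. *)
have D1 : - (2^-1 * bil ('D_Y (G i) y) Y Y) <= T * (d * q).
  rewrite (le_trans (ler_norm _)) // normrN normrM ger0_norm ?invr_ge0 //.
  apply: (@le_trans _ _ `|bil ('D_Y (G i) y) Y Y|).
    by rewrite ler_piMl // invf_le1 // ler1n.
  have DT : `|'D_Y (G i) y| <= `|Y| * T.
    have dG := chart_gram_diff g _ _ iy.
    rewrite derive_rVE // (le_trans (ler_norm_sum _ _ _)) // mulr_sumr.
    by apply: ler_sum => a _; rewrite normrZ ler_pM // mx_coord_le.
  rewrite (le_trans (bil_le _ _ _)) //.
  apply: (@le_trans _ _ (n%:R ^+ 2 * (`|Y| * T) * (`|Y| * `|Y|))).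
    by rewrite ler_wpM2r ?mulr_ge0 // ler_wpM2l ?exprn_ge0.
  have -> : n%:R ^+ 2 * (`|Y| * T) * (`|Y| * `|Y|) = T * (`|Y| * q) by rewrite /q; ring.
  by rewrite ler_wpM2l // ler_wpM2r.
have YS : `|Y| * `|Y| <= K * S by rewrite -expr2; exact: Ky.
have : bil (coord_hess i y) Y Y - 2^-1 * bil ('D_Y (G i) y) Y Y <=
    l * S + (1 + `|l| + T) * (d * q).
  exact: sum_error_le J1 (hl Y) G1 D1.
move=> /le_trans; apply; rewrite [leRHS]mulrDl lerD2l.
apply: (@le_trans _ _ (d * C * S)).
  rewrite /q /C [leRHS](_ : _ = (1 + `|l| + T) * (d * (n%:R ^+ 2 * (K * S)))); last by ring.
  rewrite !ler_wpM2l ?addr_ge0 ?exprn_ge0 //; exact: ltW.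
by rewrite ler_wpM2r //; apply: posdef_ge0; exact: chart_gram_posdef.
Qed.

End Curvature.
End LocalEstimates.

(** * Operator norm, retraction and distance *)

Lemma linear_scale (R : pzRingType) (V W : lmodType R) (A : V -> W) a v :
  linear A -> A (a *: v) = a *: A v.
Proof.
move=> lA; pose Al := GRing.isLinear.Build _ _ _ _ A lA.
pose AL : {linear V -> W} := HB.pack A Al.
by rewrite -[A]/(AL : _ -> _) linearZ.
Qed.

Section Opnorm.
Context {R : realType} {n : nat} {M : smoothManifold R n}.
Context (g : riemannianMetric M).

(** A supremum bounds its set only if the set is bounded; here this comes from finite dimension, by
    comparing the metric norm with the coordinate norm. *)
Lemma opnorm_bounded x (A : 'rV[R]_n -> 'rV[R]_n) : linear A ->
  has_ubound [set tnorm g x (A s) | s in [set s | tnorm g x s <= 1]].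
Proof.
move=> lA; have cx := dom_chart_at M x.
have [K K0 /nbhs_singleton[_]] := near_norm_equiv g _ _ (img_phi _ _ cx).
rewrite chart_gram_at => HK.
pose T := \sum_(i < n) `|A (delta_mx 0 i)|.
have T0 : 0 <= T by apply: sumr_ge0.
have AT v : `|A v| <= T * `|v|.
  pose Al := GRing.isLinear.Build _ _ _ _ A lA.
  pose AL : {linear 'rV[R]_n -> 'rV[R]_n} := HB.pack A Al.
  rewrite -[A]/(AL : _ -> _) {1}(row_sum_delta v) linear_sum mulr_suml.
  rewrite (le_trans (ler_norm_sum _ _ _)) // ler_sum // => i _.
  by rewrite linearZ normrZ mulrC ler_wpM2l // mx_coord_le.
exists (K * T) => _ [s /= s1 <-].
rewrite -(ler_pXn2r (n := 2)) ?nnegrE ?tnorm_ge0 ?mulr_ge0 ?(ltW K0) // tnorm_sqr.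
have [_ h1] := HK (A s); have [h2 _] := HK s.
apply: le_trans h1 _; rewrite [leRHS](_ : _ = K * (T ^+ 2 * K)); last by ring.
rewrite ler_wpM2l ?(ltW K0) //.
apply: (@le_trans _ _ ((T * `|s|) ^+ 2)).
  by rewrite ler_pXn2r ?nnegrE ?mulr_ge0.
rewrite exprMn ler_wpM2l ?sqr_ge0 //; apply: le_trans h2 _.
rewrite ler_piMr ?(ltW K0) // -[bil _ _ _]/(inner g x s s) -tnorm_sqr.
by rewrite exprn_ile1 // tnorm_ge0.
Qed.

Lemma inner_opnorm x (A : 'rV[R]_n -> 'rV[R]_n) s : linear A ->
  `|inner g x s (A s)| <= opnorm g x A * tnorm g x s ^+ 2.
Proof.
move=> lA; apply: le_trans (inner_le_tnorm _ _ _ _) _.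
rewrite expr2 mulrA (mulrC (tnorm g x s)) ler_wpM2r ?tnorm_ge0 //.
have [->|s0] := eqVneq s 0.
  rewrite -(scale0r 0) (linear_scale _ _ _ _ _ _ lA) !scale0r /tnorm /inner.
  by rewrite -[in_product _ _ _ _]/(bil _ _ _) bil0l sqrtr0 mulr0.
have ns : 0 < tnorm g x s.
  rewrite lt_neqAle tnorm_ge0 andbT eq_sym; apply: contraNneq s0.
  by move=> /tnorm_eq0 ->.
rewrite -ler_pdivrMr // mulrC -[X in X * _]ger0_norm ?invr_ge0 ?tnorm_ge0 //.
rewrite -tnormZ; apply: ub_le_sup; first exact: opnorm_bounded.
exists ((tnorm g x s)^-1 *: s) => /=.
  by rewrite tnormZ ger0_norm ?invr_ge0 ?tnorm_ge0 // mulVf // gt_eqF.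
by rewrite (linear_scale _ _ _ _ _ _ lA).
Qed.

End Opnorm.

Section Retraction.
Context {R : realType} {n : nat} {M : smoothManifold R n}.
Context (g : riemannianMetric M) (Rt : M -> 'rV[R]_n -> M).
Hypothesis hRt : is_retraction Rt.

Lemma retraction0 x : Rt x 0 = x.
Proof. by have [_ /(_ x 0)[]] := hRt; rewrite scale0r. Qed.

Lemma sum_pair_delta (V : normedModType R) (w : 'rV[R]_n) :
  \sum_i w 0 i *: ((0, delta_mx 0 i) : V * 'rV[R]_n) = (0, w).
Proof.
rewrite [LHS]surjective_pairing (big_morph fst (fun _ _ => erefl) erefl).
rewrite (big_morph snd (fun _ _ => erefl) erefl) /=.
by rewrite -row_sum_delta big1 // => i _; rewrite scaler0.
Qed.

(** In the tangent-bundle coordinates [(y, w)] of one chart the retraction is a C^1 map that fixes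
    the zero section, so a Lipschitz bound along the fiber bounds the displacement, uniformly in the
    base point. *)
Lemma retraction_near x0 : let i := chart_at x0 in
  exists2 C, 0 <= C & exists2 d, 0 < d & \forall x \near x0, dom i x /\
    forall s, tnorm g x s < d ->
      dom i (Rt x s) /\ `|phi i (Rt x s) - phi i x| <= C * tnorm g x s.
Proof.
move=> i; have ix0 := dom_chart_at M x0; have iy0 := img_phi _ _ ix0.
set y0 := phi i x0 in iy0.
pose h (z : 'rV[R]_n * 'rV[R]_n) := Rt (psi i z.1) (of_chart i (psi i z.1) z.2).
have [oB CB] := hRt.1 i 1%N i; rewrite -/h in oB CB.
set B := _ `&` _ in oB CB.
have h0 y : h (y, 0) = psi i y.
  by rewrite /h /of_chart /= derive0 retraction0.
have By0 : B (y0, 0).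
  by split => //; rewrite /preimage /= h0 phiK.
pose b (a : 'I_n) : 'rV[R]_n * 'rV[R]_n := (0, delta_mx 0 a).
have [C C0 [d1 d10 HC]] := C1_lipschitz_span _ _ _ _ _ _ b oB CB By0.
have [r r0 Br] := near_norm_ball _ _ _ (open_nbhs_nbhs (conj oB By0)).
have [K K0 NK] := near_norm_equiv g _ _ iy0.
pose e := Num.min d1 r.
have e0 : 0 < e by rewrite lt_min d10 r0.
pose k := Num.sqrt K.
have k0 : 0 < k by rewrite sqrtr_gt0.
exists (C * k); first by rewrite mulr_ge0 // ltW.
exists (e / k); first by rewrite divr_gt0.
have Ny : \forall y \near y0, `|y - y0| < e.
  apply/nbhs_ballP; exists e => // y; rewrite -ball_normE /= distrC //.
apply: filterS2 (near_phi _ _ _ ix0 NK) (near_phi _ _ _ ix0 Ny).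
move=> x [ix [iy HK]] [_ ye]; split => // s se.
set y := phi i x in iy HK ye *.
pose w := to_chart i x s.
have ww : `|w| <= k * tnorm g x s.
  rewrite /k /tnorm -sqrtrM ?(ltW K0) // (inner_chart g i) //.
  rewrite -[leLHS]ger0_norm // -sqrtr_sqr ler_wsqrtr //.
  by have [] := HK w.
have we : `|w| < e by rewrite (le_lt_trans ww) // mulrC -ltr_pdivlMr.
have hs : Rt x s = h (y, w) by rewrite /h /= /y phiK // to_chartK.
have dist (w' : 'rV[R]_n) : `|w'| < e -> `|(y, w') - (y0, 0)| < e.
  by move=> w'e; rewrite prod_normE /= subr0 gt_max ye w'e.
have lt1 u : u < e -> u < d1 by rewrite lt_min => /andP[].
have lt2 u : u < e -> u < r by rewrite lt_min => /andP[].
have [_ Bh] : B (y, w) by apply: Br; apply: lt2; exact: dist.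
split; first by rewrite hs.
have n0 : `|0 : 'rV[R]_n| < e by rewrite normr0.
have := HC (y, 0) w (lt1 _ (dist _ n0)) (lt1 _ we); rewrite /b sum_pair_delta.
have -> : ((y, 0) + (0, w) : 'rV[R]_n * 'rV[R]_n) = (y, w).
  by congr (_, _) => /=; rewrite ?addr0 ?add0r.
rewrite /= h0 -hs /y phiK // => /le_trans; apply.
by rewrite -mulrA ler_wpM2l.
Qed.

End Retraction.

(** * Lower curvature bound along the gradient *)

(** [F] is the gap, [S] the gradient norm, [h] the Hessian form at the gradient. In units of
    [X = (S / b) ^+ 2] the PL bound gives at most [b / 2], the linear term gives [- b], the
    quadratic one less than [m / 2] and the cubic one at most [(b - m) / 6]: in total less than
    [- (b - m) / 3]. *)
Lemma descent_contradiction (R : realFieldType) (F S h mu m b L : R) :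
  0 < m -> m < b -> b < mu -> 0 <= L -> 0 <= S -> L * S <= b * (b - m) ->
  h < m * S ^+ 2 -> F <= 1 / (2 * mu) * S ^+ 2 ->
  0 <= F - b^-1 * S ^+ 2 + 2^-1 * (b^-1 * (b^-1 * h)) + L / 6 * (b^-1 * S) ^+ 3 ->
  False.
Proof.
move=> m0 mb bmu L0 S0 LS hm Fmu.
have b0 : 0 < b by apply: lt_trans mb.
have mu0 : 0 < mu by apply: lt_trans bmu.
have tb : b^-1 * b = 1 by rewrite mulVf // gt_eqF.
have t0 : 0 < b^-1 by rewrite invr_gt0.
have ut : mu^-1 < b^-1 by rewrite ltf_pV2.
move: Fmu; rewrite mul1r invfM; set u := mu^-1 in ut *; set t := b^-1 in tb t0 ut *.
move=> Fmu; pose X := t ^+ 2 * S ^+ 2.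
have X0 : 0 <= X by rewrite mulr_ge0 ?sqr_ge0.
have LSt : L * S * t <= b - m.
  apply: (@le_trans _ _ (b * (b - m) * t)); first by rewrite ler_wpM2r // ltW.
  by rewrite mulrC mulrA tb mul1r.
have E1 : L / 6 * (t * S) ^+ 3 <= X * (b - m) / 6.
  have -> : L / 6 * (t * S) ^+ 3 = X * (L * S * t) / 6 by rewrite /X; ring.
  by rewrite ler_wpM2r ?invr_ge0 // ler_wpM2l.
have E2 : t * (t * h) < X * m.
  have -> : X * m = t * (t * (m * S ^+ 2)) by rewrite /X; ring.
  by rewrite !ltr_pM2l.
have E3 : X * b = t * S ^+ 2.
  have -> : X * b = t * (t * b) * S ^+ 2 by rewrite /X; ring.
  by rewrite tb mulr1.
have E4 : u * S ^+ 2 <= t * S ^+ 2 by rewrite ler_wpM2r ?sqr_ge0 // ltW.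
have E5 : 0 <= X * (b - m) by rewrite mulr_ge0 // subr_ge0 ltW.
have E6 : X * (b - m) = t * S ^+ 2 - X * m by rewrite mulrBr E3.
move: Fmu E1 E2 E4 E5; rewrite E6 => Fmu E1 E2 E4 E5; lra.
Qed.

Section CurvatureBelow.
Context {R : realType} {n : nat} {M : smoothManifold R n}.
Context (g : riemannianMetric M) (Rt : M -> 'rV[R]_n -> M).
Hypothesis hRt : is_retraction Rt.
Context (f : M -> R) (hf : Ck_fun 2 f).

Lemma near_retraction (x0 : M) (P : set M) : nbhs x0 P ->
  exists2 d : R, 0 < d & \forall x \near x0, forall s, tnorm g x s < d -> P (Rt x s).
Proof.
move=> NP; have [C C0 [d d0 H]] := retraction_near g Rt hRt x0.
set i := chart_at x0 in H; have ix0 := dom_chart_at M x0.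
have iy0 := img_phi _ _ ix0.
have N1 : \forall y \near phi i x0, P (psi i y).
  by apply: (near_psi i _ P iy0); rewrite phiK.
have [r r0 rP] := near_norm_ball _ _ _ N1.
have r2 : 0 < r / 2 by rewrite divr_gt0.
have C1 : 0 < C + 1 by rewrite ltr_wpDl.
exists (Num.min d (r / 2 / (C + 1))); first by rewrite lt_min d0 divr_gt0.
have Ny : \forall y \near phi i x0, `|y - phi i x0| < r / 2.
  by apply/nbhs_ballP; exists (r / 2) => // y; rewrite -ball_normE /= distrC.
apply: filterS2 H (near_phi _ _ _ ix0 Ny) => x [ix Hx] [_ xr] s.
rewrite lt_min => /andP[sd sr]; have [iR dR] := Hx s sd.
rewrite -(phiK _ i _ iR); apply: rP.
rewrite -(subrK (phi i x) (phi i (Rt x s))) -addrA (splitr r).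
rewrite (le_lt_trans (ler_normD _ _)) // ltrD //.
rewrite (le_lt_trans dR) // (@le_lt_trans _ _ (tnorm g x s * (C + 1))) //.
  by rewrite mulrC ler_wpM2l ?tnorm_ge0 // lerDl.
by rewrite -ltr_pdivlMr.
Qed.

(* Otherwise A2 at s = - grad f / b, with m < b < mu, would violate the PL bound. *)
Lemma near_hess_ge (xbar : M) (mu m LH : R) : local_min f xbar -> 0 < m < mu ->
  0 <= LH ->
  near_zero_vector g xbar (fun x s =>
     f (Rt x s) - f x - inner g x s (grad g f x)
       - 2^-1 * inner g x s (hess g f x s) <= LH / 6 * tnorm g x s ^+ 3) ->
  (\forall x \near xbar,
     f x - f xbar <= 1 / (2 * mu) * tnorm g x (grad g f x) ^+ 2) ->
  \forall x \near xbar, m * tnorm g x (grad g f x) ^+ 2 <=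
    inner g x (grad g f x) (hess g f x (grad g f x)).
Proof.
move=> fmin /andP[m0 mmu] LH0 [N1 NN1 [d1 d10 A2]] PL.
have gx0 := local_min_grad g f hf _ fmin.
have [d2 d20 fR] := near_retraction _ _ fmin.
pose b := (m + mu) / 2.
have mb : m < b by rewrite /b; lra.
have bmu : b < mu by rewrite /b; lra.
have b0 : 0 < b by apply: lt_trans mb.
(* The first bound keeps the step [- b^-1 *: grad f x] within the radii [d1] and [d2], the second
   gives [LH * S <= b * (b - m)]. *)
pose e := Num.min (b * Num.min d1 d2) (b * (b - m) / (LH + 1)).
have LH1 : 0 < LH + 1 by rewrite ltr_wpDl.
have e0 : 0 < e.
  rewrite lt_min; apply/andP; split; first by rewrite mulr_gt0 // lt_min d10.
  by rewrite divr_gt0 // mulr_gt0 // subr_gt0.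
have Ng := near_tnorm_grad g f hf _ _ gx0 e0.
apply: filterS (filterI NN1 (filterI PL (filterI fR Ng))).
move=> x [Nx [PLx [fRx gx]]].
set G := grad g f x in PLx gx *; set S := tnorm g x G.
rewrite leNgt; apply/negP => lt.
have S0 : 0 <= S by exact: tnorm_ge0.
have Hl a : hess g f x (a *: G) = a *: hess g f x G.
  by apply: linear_scale; exact: hess_linear.
have ns : tnorm g x (- b^-1 *: G) = b^-1 * S.
  by rewrite tnormZ normrN ger0_norm ?invr_ge0 // ltW.
set h := inner g x G _ in lt.
move: gx; rewrite /e !lt_min => /andP[gd gL].
have sd : tnorm g x (- b^-1 *: G) < Num.min d1 d2.
  by rewrite ns mulrC ltr_pdivrMr // mulrC.
move: sd; rewrite lt_min => /andP[sd1 sd2].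
have := A2 x _ Nx sd1; have := fRx _ sd2; rewrite ns Hl.
rewrite -[inner g x _ G]/(bil (g x) (- b^-1 *: G) G) bilZl.
rewrite -[inner g x _ (_ *: _)]/(bil (g x) (- b^-1 *: G) (- b^-1 *: hess g f x G)).
rewrite bilZl bilZr -[bil _ _ (hess _ _ _ _)]/h -[bil _ _ _]/(inner g x G G).
rewrite -tnorm_sqr -/S => fR1 A2x.
apply: (@descent_contradiction R (f x - f xbar) S h mu m b LH) => //.
  rewrite (@le_trans _ _ ((LH + 1) * S)) ?ler_wpM2r ?lerDl //.
  by rewrite mulrC -ler_pdivlMr // ltW.
move: fR1 A2x; rewrite /= => fR1 A2x; lra.
Qed.

End CurvatureBelow.

(** * Curve length and Riemannian distance in a chart *)

Section Distance.
Context {R : realType} {n : nat} {M : smoothManifold R n}.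
Context (g : riemannianMetric M).

Lemma derive_line_scale (V : normedModType R) (y u : V) (a t : R) :
  'D_a (fun t : R => y + t *: u) t = a *: u.
Proof.
rewrite -[in LHS](mulr1 a) deriveE; last exact: differentiable_line.
by rewrite -[a * 1]/(a *: 1) linearZ -deriveE ?derive_line.
Qed.

Lemma segment_in_ball (y0 y z : 'rV[R]_n) (r t : R) :
  `|y - y0| < r -> `|z - y0| < r -> 0 <= t <= 1 ->
  `|y + t *: (z - y) - y0| < r.
Proof.
move=> yr zr /andP[t0 t1].
have -> : y + t *: (z - y) - y0 = (1 - t) *: (y - y0) + t *: (z - y0).
  by apply/rowP => k; rewrite !mxE; ring.
apply: le_lt_trans (ler_normD _ _) _; rewrite !normrZ (ger0_norm t0).
rewrite ger0_norm ?subr_ge0 //.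
have [->|tp] := eqVneq t 0; first by rewrite subr0 mul1r mul0r addr0.
have {}tp : 0 < t by rewrite lt_neqAle eq_sym tp.
have -> : r = (1 - t) * r + t * r by ring.
by rewrite ler_ltD // ?ltr_pM2l // ler_wpM2l ?subr_ge0 // ltW.
Qed.

Lemma segment_C1_arc i (y0 y z : 'rV[R]_n) r :
  (forall w, `|w - y0| < r -> img i w) -> `|y - y0| < r -> `|z - y0| < r ->
  C1_arc (fun t : R => psi i (y + t *: (z - y)) : M).
Proof.
move=> ball_img yr zr; set u := z - y.
have cl t : {for t, continuous (fun t : R => y + t *: u)}.
  by apply: differentiable_continuous; exact: differentiable_line.
(* A [C1_arc] needs an open set of parameters around [[0, 1]]; this one is open because the ball is,
   and contains [[0, 1]] because the ball is convex. *)
pose A : set R := [set t | `|y + t *: u - y0| < r].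
have oA : open A.
  have -> : A = (fun t => `|y + t *: u - y0|) @^-1` [set w | w < r] by [].
  apply: open_comp; last exact: open_lt.
  move=> t _; apply: (@continuous_comp _ _ _ (fun t : R => y + t *: u - y0) (fun w => `|w|)).
    by apply: continuousB; [exact: cl|exact: cst_continuous].
  exact: norm_continuous.
exists A; split => //.
- move=> t; rewrite /= in_itv /= => /andP[t0 t1]; rewrite /A /=.
  by apply: segment_in_ball => //; rewrite t0 t1.
- move=> j; have cpsi t : A t -> {for t, continuous (fun t : R => psi i (y + t *: u) : M)}.
    move=> At; apply: (@continuous_comp _ _ _ (fun t : R => y + t *: u) (psi i)) => //.
    by apply: psi_continuous; exact: ball_img.
  set B := _ `&` _.
  have oB : open B.
    rewrite openE => t [At jt]; rewrite /interior.
    apply: filterI; first exact: open_nbhs_nbhs.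
    apply: cpsi => //; apply: open_nbhs_nbhs; split => //; exact: dom_open.
  have Bov t : B t -> overlap i j (y + t *: u).
    by move=> [At jt]; apply/overlapE; split => //; exact: ball_img.
  have D t v : B t -> 'D_v (phi j \o (fun t : R => psi i (y + t *: u))) t =
      'D_(v *: u) (phi j \o psi i) (y + t *: u).
    move=> Bt; have := @derive_comp R R _ _ (fun t => y + t *: u) (phi j \o psi i) t v.
    rewrite derive_line_scale => <- //; exact: transition_diff (Bov _ Bt).
  split => //; split=> [t Bt|v t Bt].
    apply: (@differentiable_comp _ _ _ _ (fun t : R => y + t *: u) (phi j \o psi i)) => //.
    exact: transition_diff (Bov _ Bt).
  have E : \forall s \near t, 'D_(v *: u) (phi j \o psi i) (y + s *: u) =
      'D_v (phi j \o (fun t : R => psi i (y + t *: u))) s.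
    by apply: filterS (open_nbhs_nbhs (conj oB Bt)) => s Bs; rewrite D.
  apply: (near_eq_continuous _ _ _ _ _ E).
  apply: (@continuous_comp _ _ _ (fun t : R => y + t *: u)
    ('D_(v *: u) (phi j \o psi i)) t (cl t)).
  have [_ /(_ (v *: u))] := transition_smooth M i j 1.
  by apply; exact: Bov.
Qed.

Lemma segment_velocity i (y u : 'rV[R]_n) (t : R) : img i (y + t *: u) ->
  velocity (fun t : R => psi i (y + t *: u) : M) t =
  of_chart i (psi i (y + t *: u)) u.
Proof.
move=> it; rewrite /velocity derive1E /of_chart.
set c := chart_at _; rewrite psiK //.
have cx := dom_chart_at M (psi i (y + t *: u)).
have ov : overlap i c (y + t *: u) by apply/overlapE.
have := @derive_comp R R _ _ (fun t => y + t *: u) (phi c \o psi i) t 1.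
rewrite derive_line => <- //; exact: transition_diff.
Qed.

Lemma tnorm_of_chart i (y w : 'rV[R]_n) : img i y ->
  tnorm g (psi i y) (of_chart i (psi i y) w) = Num.sqrt (bil (chart_gram g i y) w w).
Proof.
move=> iy; have ix := psi_dom _ _ iy.
rewrite /tnorm (inner_chart g i _ _ _ ix) (of_chartK i _ w ix) (psiK i y iy).
reflexivity.
Qed.

(** The coordinate segment is one admissible curve, parametrized by [[0, 1]] with metric speed at
    most [K]. *)
Lemma rdist_segment_le i (y0 y z : 'rV[R]_n) r K :
  (forall w, `|w - y0| < r -> img i w /\ bil (chart_gram g i w) (z - y) (z - y) <= K ^+ 2) ->
  0 <= K -> `|y - y0| < r -> `|z - y0| < r ->
  (rdist g (psi i y) (psi i z) <= K%:E)%E.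
Proof.
move=> H K0 yr zr; set u := z - y in H *.
have Hi w : `|w - y0| < r -> img i w by case/H.
pose c (t : R) : M := psi i (y + t *: u).
apply: ereal_inf_le; exists (curve_length g c + 0)%E.
  exists [:: c]; last by rewrite /= big_cons big_nil.
  split; [exact: segment_C1_arc Hi yr zr|by rewrite /c scale0r addr0|].
  by rewrite /= /c scale1r /u addrCA subrr addr0.
rewrite adde0 /curve_length.
pose q (t : R) := Num.sqrt (bil (chart_gram g i (y + t *: u)) u u).
have seg t : t \in `[0, 1] -> `|y + t *: u - y0| < r.
  by rewrite in_itv => t01; exact: segment_in_ball.
have -> : (\int[lebesgue_measure]_(t in `[0%R, 1%R]) (tnorm g (c t) (velocity c t))%:E =
    \int[lebesgue_measure]_(t in `[0%R, 1%R]) `|(q t)%:E|)%E.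
  apply: eq_integral => t; rewrite inE /= => t01.
  have iyt : img i (y + t *: u) by apply: Hi; exact: seg.
  by rewrite ger0_norm ?sqrtr_ge0 // segment_velocity // tnorm_of_chart.
apply: le_trans (integral_le_bound K%:E _ _ _ _) _ => //.
- apply/measurable_realfun.measurable_EFinP.
  apply: measurable_realfun.subspace_continuous_measurable_fun => //.
  apply: continuous_in_subspaceT => t; rewrite inE /= => t01.
  have iyt : img i (y + t *: u) by apply: Hi; exact: seg.
  have dG : differentiable (fun w => u *m chart_gram g i w *m u^T) (y + t *: u).
    apply: differentiable_mulmx; last exact: differentiable_cst.
    by apply: differentiable_mulmx; [exact: differentiable_cst|exact: chart_gram_diff].
  have cG : {for y + t *: u, continuous (fun w => bil (chart_gram g i w) u u)}.
    apply: differentiable_continuous.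
    by move: dG => /differentiable_mxP; apply.
  have cl : {for t, continuous (fun t : R => y + t *: u)}.
    by apply: differentiable_continuous; exact: differentiable_line.
  exact: (continuous_comp (continuous_comp cl cG) (@sqrt_continuous R _)).
- apply: aeW => t /= t01; rewrite lee_fin ger0_norm ?sqrtr_ge0 //.
  rewrite -[leRHS]ger0_norm // -sqrtr_sqr ler_wsqrtr //.
  by have [] := H _ (seg _ t01).
- have mu01 : @lebesgue_measure R `[0, 1]%classic = 1%E.
    by rewrite lebesgue_measure_itv /= lte_fin ltr01 oppr0 adde0.
  apply: (@le_trans _ _ (K%:E * 1)%E); last by rewrite mule1.
  by rewrite lee_wpmul2l ?lee_fin // -mu01.
Qed.

End Distance.

(** * One Cauchy step *)

Lemma half_le_model_decrease (R : realFieldType) (t h S : R) :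
  0 <= t -> t * h <= S ^+ 2 ->
  t * S ^+ 2 / 2 <= t * S ^+ 2 - 2^-1 * (t * (t * h)).
Proof.
move=> t0 th; have : t * (t * h) <= t * S ^+ 2 by rewrite ler_wpM2l.
lra.
Qed.

(** The actual decrease misses the model decrease by at most [t ^+ 2 * b * S ^+ 3 / 2 + L * (t * S)
    ^+ 3 / 6]. With [t <= 1 / m] this is at most [(b + L / (3 * m)) / m * S] times [t * S ^+ 2 / 2],
    which the model decrease exceeds or equals. *)
Lemma actual_decrease_ge (R : realFieldType) (t m h h0 S b L fx fR : R) :
  0 < t -> 0 < m -> t * m <= 1 -> 0 <= b -> 0 <= L -> 0 <= S ->
  t * h <= S ^+ 2 -> h0 - h <= b * S * S ^+ 2 ->
  fR - fx + t * S ^+ 2 - 2^-1 * (t * (t * h0)) <= L / 6 * (t * S) ^+ 3 ->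
  (1 - (b + L / (3 * m)) / m * S) * (t * S ^+ 2 - 2^-1 * (t * (t * h)))
    <= fx - fR.
Proof.
move=> t0 m0 tm b0 L0 S0 th hh A2; set d := t * S ^+ 2 - _.
have d_ge : t * S ^+ 2 / 2 <= d by apply: half_le_model_decrease => //; exact: ltW.
set i := m^-1; have i0 : 0 < i by rewrite invr_gt0.
have ti : t <= i by rewrite -[i]mul1r ler_pdivlMr.
have -> : (b + L / (3 * m)) / m = (b + L * i / 3) * i.
  by rewrite /i invfM; field; rewrite gt_eqF.
set c := (b + L * i / 3) * i.
have c0 : 0 <= c.
  by rewrite /c mulr_ge0 ?addr_ge0 ?divr_ge0 ?mulr_ge0 // ltW.
have E1 : c * S * (t * S ^+ 2 / 2) <= c * S * d.
  by rewrite ler_wpM2l // mulr_ge0.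
have E2 : t * (t * (h0 - h)) <= t * (i * (b * S * S ^+ 2)).
  rewrite ler_wpM2l ?(ltW t0) //.
  apply: (@le_trans _ _ (t * (b * S * S ^+ 2))); first by rewrite ler_wpM2l // ltW.
  by rewrite ler_wpM2r // !mulr_ge0 ?sqr_ge0.
have E3 : L / 6 * (t * S) ^+ 3 <= L / 6 * (t * i ^+ 2 * S ^+ 3).
  rewrite ler_wpM2l ?divr_ge0 // exprMn ler_wpM2r ?exprn_ge0 //.
  by rewrite exprS ler_wpM2l ?(ltW t0) // ler_sqr ?nnegrE ?(ltW t0) ?(ltW i0).
have E4 : c * S * (t * S ^+ 2 / 2) =
    2^-1 * (t * (i * (b * S * S ^+ 2))) + L / 6 * (t * i ^+ 2 * S ^+ 3).
  by rewrite /c; field.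
have E5 : t * (t * (h0 - h)) = t * (t * h0) - t * (t * h) by ring.
rewrite mulrBl mul1r; move: E1 E2 E3 A2; rewrite E4 E5 /d.
set x1 := t * (t * h0); set x2 := t * (t * h); set x3 := L / 6 * _.
set x4 := L / 6 * _; set x5 := t * S ^+ 2; set x6 := t * (i * _).
set x7 := c * S * _ => E1 E2 E3 A2; lra.
Qed.

(** Lojasiewicz argument with the square root as desingularizing function: PL reads
    [2 * nu * sqrt a <= S], and [a - b <= (sqrt a - sqrt b) * (2 * sqrt a)]. The factor [S] cancels,
    leaving the step length [w]. *)
Lemma sqrt_decrease (R : rcfType) (a b c w S mu : R) :
  0 <= b -> 0 <= c -> 0 <= w -> 0 < S -> 0 < mu ->
  a <= 1 / (2 * mu) * S ^+ 2 -> c * (w * S) <= a - b ->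
  c * Num.sqrt (mu / 2) * w <= Num.sqrt a - Num.sqrt b.
Proof.
move=> b0 c0 w0 S0 mu0 aS ab.
have cw0 : 0 <= c * (w * S) by rewrite !mulr_ge0 // ltW.
have ba : b <= a by rewrite -subr_ge0 (le_trans cw0).
have a0 : 0 <= a by apply: le_trans ba.
have nu0 : 0 < Num.sqrt (mu / 2) by rewrite sqrtr_gt0 divr_gt0.
set nu := Num.sqrt (mu / 2) in nu0 *.
have nu2 : nu ^+ 2 = mu / 2 by rewrite sqr_sqrtr // ltW // divr_gt0.
set sa := Num.sqrt a; set sb := Num.sqrt b.
have sb0 : 0 <= sb by exact: sqrtr_ge0.
have sba : sb <= sa by exact: ler_wsqrtr.
have sa2 : sa ^+ 2 = a by exact: sqr_sqrtr.
have sb2 : sb ^+ 2 = b by exact: sqr_sqrtr.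
have E1 : 2 * nu * sa <= S.
  rewrite -(ler_pXn2r (n := 2)) ?nnegrE ?mulr_ge0 ?(ltW nu0) ?(ltW S0) //; last first.
    exact: le_trans sba.
  rewrite !exprMn nu2 sa2.
  have -> : S ^+ 2 = 2 ^+ 2 * (mu / 2) * (1 / (2 * mu) * S ^+ 2).
    by field; rewrite gt_eqF.
  by rewrite ler_wpM2l // mulr_ge0 ?exprn_ge0 // divr_ge0 // ltW.
have E2 : c * (w * S) <= (sa - sb) * (2 * sa).
  apply: le_trans ab _; rewrite -sa2 -sb2 subr_sqr ler_wpM2l ?subr_ge0 //.
  by rewrite mulrDl !mul1r lerD2l.
have E3 : (sa - sb) * (2 * sa) * nu <= (sa - sb) * S.
  rewrite -mulrA ler_wpM2l ?subr_ge0 //.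
  by rewrite (_ : 2 * sa * nu = 2 * nu * sa) //; ring.
rewrite -(ler_pM2r S0).
apply: le_trans E3; rewrite (_ : c * nu * w * S = c * (w * S) * nu); last by ring.
by rewrite ler_wpM2r // ltW.
Qed.

Section Step.
Context {R : realType} {n : nat} {M : smoothManifold R n}.
Context (g : riemannianMetric M) (Rt : M -> 'rV[R]_n -> M).
Context (f : M -> R) (hf : Ck_fun 2 f).
Implicit Types (x : M) (A : 'rV[R]_n -> 'rV[R]_n).

Lemma innerZ x a b u v : inner g x (a *: u) (b *: v) = a * (b * inner g x u v).
Proof. by rewrite -![inner _ _ _ _]/(bil (g x) _ _) bilZl bilZr. Qed.

Lemma inner0 x v : inner g x 0 v = 0.
Proof. by rewrite -[inner _ _ _ _]/(bil (g x) _ _) bil0l. Qed.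

Lemma tr_model_decrease x A (t : R) : linear A ->
  tr_model g f x A 0 - tr_model g f x A (- t *: grad g f x) =
  t * tnorm g x (grad g f x) ^+ 2
    - 2^-1 * (t * (t * inner g x (grad g f x) (A (grad g f x)))).
Proof.
move=> lA; rewrite /tr_model (linear_scale _ _ _ _ _ _ lA) innerZ !inner0.
rewrite -[X in inner g x (- t *: _) X]scale1r innerZ tnorm_sqr; ring.
Qed.

(** Curvature at least [m > 0] selects the branch with the minimum and bounds [t] by [1 / m]; the
    last clause says whether the radius or the unconstrained minimizer is active. *)
Lemma cauchy_time_spec x A (D m : R) : let S := tnorm g x (grad g f x) in
  let h := inner g x (grad g f x) (A (grad g f x)) in
  let t := cauchy_time g f x A D in
  0 < D -> 0 < S -> 0 < m -> m * S ^+ 2 <= h ->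
  [/\ 0 < t, t * m <= 1, t * S <= D, t * h <= S ^+ 2 &
      t = D / S \/ t * h = S ^+ 2].
Proof.
move=> S h t D0 S0 m0 mh.
have h0 : 0 < h by apply: lt_le_trans mh; rewrite mulr_gt0 ?exprn_gt0.
have tE : t = Num.min (S ^+ 2 / h) (D / S) by rewrite /t /cauchy_time -/h h0.
have th : t * h <= S ^+ 2 by rewrite -ler_pdivlMr // tE ge_min lexx.
have tD : t * S <= D by rewrite -ler_pdivlMr // tE ge_min lexx orbT.
have t0 : 0 < t by rewrite tE lt_min !divr_gt0 ?exprn_gt0.
split => //.
  have S2 : 0 < S ^+ 2 by rewrite exprn_gt0.
  rewrite -(ler_pM2r S2) mul1r -mulrA; apply: le_trans th.
  by rewrite ler_wpM2l // ltW.
rewrite tE /Num.min; case: ifP => _; [right|by left].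
by rewrite divfK // gt_eqF.
Qed.

Lemma cauchy_tr_step x A (D m b L : R) :
  let G := grad g f x in let S := tnorm g x G in
  let h := inner g x G (A G) in let s := cauchy_step g f x A D in
  let C := (b + L / (3 * m)) / m in
  0 < D -> 0 < S -> 0 < m -> 0 <= b -> 0 <= L -> linear A ->
  m * S ^+ 2 <= h ->
  opnorm g x (fun v => A v - hess g f x v) <= b * S ->
  C * S < 1 / 4 ->
  (forall s, tnorm g x s * m <= S ->
     f (Rt x s) - f x - inner g x s G - 2^-1 * inner g x s (hess g f x s)
       <= L / 6 * tnorm g x s ^+ 3) ->
  exists t, [/\ tnorm g x s = t * S, 0 < t /\ t * m <= 1, t * S <= D,
    t = D / S \/ t * h = S ^+ 2 &
    [/\ t * S ^+ 2 / 2 <= t * S ^+ 2 - 2^-1 * (t * (t * h)),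
    (1 - C * S) * (t * S ^+ 2 - 2^-1 * (t * (t * h))) <= f x - f (Rt x s) &
    3 / 4 < tr_ratio g f Rt x A s]].
Proof.
move=> G S h s C D0 S0 m0 b0 L0 lA mh opn CS A2.
have G0 : G != 0.
  by apply: contraTneq S0 => G0; rewrite /S G0 /tnorm inner0 sqrtr0 ltxx.
have [t0 tm tD th tc] := cauchy_time_spec x A D m D0 S0 m0 mh.
set t := cauchy_time g f x A D in t0 tm tD th tc.
have sE : s = - t *: G by rewrite /s /cauchy_step (negbTE G0).
have ns : tnorm g x s = t * S by rewrite sE tnormZ normrN gtr0_norm.
have dge := half_le_model_decrease _ t h S (ltW t0) th.
have lH := hess_linear g f hf x.
have act : (1 - C * S) * (t * S ^+ 2 - 2^-1 * (t * (t * h))) <= f x - f (Rt x s).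
  apply: (@actual_decrease_ge _ t m h (inner g x G (hess g f x G))) => //; first exact: ltW.
    have lB : linear (fun v => A v - hess g f x v).
      by move=> a u v; rewrite lA lH scalerBr opprD addrACA.
    have := inner_opnorm g x _ G lB.
    have -> : inner g x G (A G - hess g f x G) = h - inner g x G (hess g f x G).
      by rewrite -![inner _ _ _ _]/(bil (g x) _ _) bilDr bilNr.
    move=> o1; rewrite -opprB; apply: le_trans (ler_norm _) _; rewrite normrN.
    by apply: le_trans o1 _; rewrite ler_wpM2r // sqr_ge0.
  have := A2 s; rewrite ns mulrAC => /(_ _)/=.
  rewrite sE (linear_scale _ _ _ _ _ _ lH) innerZ -[X in inner g x (- t *: _) X]scale1r innerZ.
  rewrite mul1r -tnorm_sqr -/S.
  have -> : f (Rt x (- t *: G)) - f x - - t * S ^+ 2 -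
    2^-1 * (- t * (- t * inner g x G (hess g f x G))) =
    f (Rt x (- t *: G)) - f x + t * S ^+ 2 -
    2^-1 * (t * (t * inner g x G (hess g f x G))) by ring.
  by apply; rewrite -[leRHS]mul1r ler_wpM2r // ltW.
exists t; split => //; split => //.
have dpos : 0 < t * S ^+ 2 - 2^-1 * (t * (t * h)).
  by apply: lt_le_trans dge; rewrite divr_gt0 // mulr_gt0 // exprn_gt0.
(* The model decrease is positive, so the ratio is a genuine quotient and is at least
   [1 - C * S]. *)
rewrite /tr_ratio [in tr_model _ _ _ _ s]sE tr_model_decrease // -/S -/h gt_eqF //.
rewrite ltr_pdivlMr //; apply: lt_le_trans act; rewrite ltr_pM2r //.
by move: CS; set c := C * S; lra.
Qed.

End Step.

(** * The neighborhood where all local estimates hold *)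

Section Tame.
Context {R : realType} {n : nat} {M : smoothManifold R n}.
Context (g : riemannianMetric M) (Rt : M -> 'rV[R]_n -> M).
Context (f : M -> R) (xbar : M) (mu betaH LH : R) (N U : set M).

(** The constant of [actual_decrease_ge] for [m = mu / 4]. *)
Definition decrease_defect : R := (betaH + LH / (3 * (mu / 4))) / (mu / 4).

(** Everything used about an iterate, as a condition on the point alone, so that membership in a
    ball is all the trajectory has to maintain. The vectors [s] considered include every Cauchy
    step, whose time is at most [4 / mu]. *)
Definition tame (Lam C1 : R) (x : M) : Prop :=
  let i := chart_at xbar in
  let G := grad g f x in let S := tnorm g x G in
  [/\ f xbar <= f x /\ f x - f xbar <= 1 / (2 * mu) * S ^+ 2,
      N x /\ U x,
      mu / 2 * S ^+ 2 <= inner g x G (hess g f x G) <= Lam * S ^+ 2,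
      [/\ S <= 1, betaH * S <= mu / 4 & decrease_defect * S < 1 / 4] &
      forall s, tnorm g x s * (mu / 4) <= S ->
        [/\ f (Rt x s) - f x - inner g x s G - 2^-1 * inner g x s (hess g f x s)
              <= LH / 6 * tnorm g x s ^+ 3,
            f xbar <= f (Rt x s),
            dom i (Rt x s) &
            `|phi i (Rt x s) - phi i x| <= C1 * tnorm g x s]].

Hypothesis hRt : is_retraction Rt.
Hypothesis hf : Ck_fun 2 f.
Hypothesis fmin : local_min f xbar.
Hypothesis A2 : near_zero_vector g xbar (fun x s =>
  f (Rt x s) - f x - inner g x s (grad g f x)
    - 2^-1 * inner g x s (hess g f x s) <= LH / 6 * tnorm g x s ^+ 3).
Hypothesis PL : \forall x \near xbar,
  f x - f xbar <= 1 / (2 * mu) * tnorm g x (grad g f x) ^+ 2.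
Hypotheses (hN : nbhs xbar N) (hU : nbhs xbar U).
Hypotheses (mu0 : 0 < mu) (b0 : 0 <= betaH) (L0 : 0 <= LH).

Lemma decrease_defect_ge0 : 0 <= decrease_defect.
Proof.
by rewrite /decrease_defect !(divr_ge0, addr_ge0, mulr_ge0) // ltW.
Qed.

Lemma near_tame : exists Lam C1, [/\ 0 < Lam, 0 <= C1 &
  \forall x \near xbar, tame Lam C1 x].
Proof.
have gx0 := local_min_grad g f hf _ fmin.
have mu2 : 0 < mu / 2 < mu.
  by rewrite divr_gt0 //= ltr_pdivrMr // ltr_pMr // ltr1n.
have Hlow := near_hess_ge g Rt hRt f hf _ _ _ _ fmin mu2 L0 A2 PL.
have Hup := near_hess_le g f hf _ _ gx0 ltr01.
set l := lambda_max _ in Hup.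
have [C1 C10 [d1 d10 HR]] := retraction_near g Rt hRt xbar.
have [d2 d20 HF] := near_retraction g Rt hRt _ _ fmin.
have [N3 HN3 [d3 d30 HA]] := A2.
pose d := Num.min d1 (Num.min d2 d3).
have d0 : 0 < d by rewrite !lt_min d10 d20 d30.
have c0 := decrease_defect_ge0.
(* The first three bounds give the three conditions of [tame] on [S]; the last brings the vectors
   [s] of its final clause within the radius [d]. *)
pose e := Num.min (Num.min 1 (mu / 4 / (betaH + 1)))
                  (Num.min (1 / 4 / (decrease_defect + 1)) (d * (mu / 4))).
have e0 : 0 < e.
  rewrite !lt_min ltr01 /=.
  by rewrite !(divr_gt0, mulr_gt0) // ltr_wpDl.
have Hg := near_tnorm_grad g f hf _ _ gx0 e0.
exists (Num.max 1 (l + 1)), C1; split => //; first by rewrite lt_max ltr01.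
apply: filterS (filterI fmin (filterI PL (filterI hN (filterI hU (filterI Hlow
  (filterI Hup (filterI HR (filterI HF (filterI HN3 Hg))))))))).
move=> x [fx [PLx [Nx [Ux [lx [ux [[ix Rx] [Fx [N3x gx]]]]]]]]].
move: gx lx ux PLx; set G := grad g f x; set S := tnorm g x G => gx lx ux PLx.
have S0 : 0 <= S by exact: tnorm_ge0.
move: gx; rewrite !lt_min => /andP[/andP[S1 S2] /andP[S3 S4]].
split; [by []|by []| | |].
- rewrite lx /=; apply: le_trans ux _; rewrite -tnorm_sqr ler_wpM2r ?sqr_ge0 //.
  by rewrite le_max lexx orbT.
- split; first exact: ltW.
    apply: (@le_trans _ _ ((betaH + 1) * S)); first by rewrite ler_wpM2r // lerDl.
    by rewrite mulrC -ler_pdivlMr ?ltr_wpDl // ltW.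
  apply: (@le_lt_trans _ _ ((decrease_defect + 1) * S)).
    by rewrite ler_wpM2r // lerDl.
  by rewrite mulrC -ltr_pdivlMr // ltr_wpDl.
move=> s sS; have : tnorm g x s < d.
  have mu4 : 0 < mu / 4 by rewrite divr_gt0.
  by rewrite -(ltr_pM2r mu4); apply: le_lt_trans sS S4.
rewrite !lt_min => /andP[sd1 /andP[sd2 sd3]].
by have [iR dR] := Rx s sd1; split => //; [exact: HA|exact: Fx].
Qed.

End Tame.

Section TameStep.
Context {R : realType} {n : nat} {M : smoothManifold R n}.
Context (g : riemannianMetric M) (Rt : M -> 'rV[R]_n -> M).
Context (f : M -> R) (xbar : M) (mu betaH LH : R) (N U : set M).
Context (Lam C1 rho' Dbar : R).
Hypotheses (hRt : is_retraction Rt) (hf : Ck_fun 2 f).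
Hypotheses (mu0 : 0 < mu) (b0 : 0 <= betaH) (L0 : 0 <= LH) (C10 : 0 <= C1).
Hypotheses (hrho : 0 < rho' < 1 / 4) (hDbar : 0 < Dbar).
Context (x : nat -> M) (D : nat -> R) (H : nat -> 'rV[R]_n -> 'rV[R]_n)
  (s : nat -> 'rV[R]_n).
Hypotheses (htr : trust_region g f Rt rho' Dbar x D H s)
  (hcs : cauchy_steps g f x D H s) (hA3 : hyp_A3 g f betaH N x H).

Local Notation i := (chart_at xbar).
Local Notation tame := (tame g Rt f xbar mu betaH LH N U Lam C1).
Local Notation S k := (tnorm g (x k) (grad g f (x k))).
Local Notation C := (decrease_defect mu betaH LH).

Definition gap k : R := f (x k) - f xbar.
(** [C1] converts a step length into a chart displacement; the denominator is the factor of
    [sqrt_decrease] for [c = 3 / 8]. *)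
Definition length_bound : R := C1 / (3 / 8 * Num.sqrt (mu / 2)).

Lemma length_bound_ge0 : 0 <= length_bound.
Proof. by rewrite divr_ge0 // mulr_ge0 ?sqrtr_ge0. Qed.

(** The step is 0 and the ratio is 1 by convention, so the radius is not reduced; it is not enlarged
    either, since [D k > 0] differs from the step length 0. *)
Lemma critical_step k : S k = 0 -> x k.+1 = x k /\ D k.+1 = D k.
Proof.
move=> S0; have gx := tnorm_eq0 _ _ _ S0.
have sk : s k = 0 by rewrite hcs /cauchy_step gx eqxx.
have [Dk _ xk Dk1] := htr k; rewrite sk in xk Dk1.
split; first by rewrite xk (retraction0 Rt hRt); case: ifP.
rewrite Dk1 /tr_ratio subrr eqxx.
have -> : (1 < 1 / 4 :> R) = false by apply/negbTE; rewrite -leNgt; lra.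
have -> : tnorm g (x k) 0 = 0 by rewrite /tnorm inner0 sqrtr0.
by rewrite [0 == _]eq_sym (gt_eqF Dk) andbF.
Qed.

Lemma tame_curvature k : tame (x k) -> let G := grad g f (x k) in
  let h := inner g (x k) G (H k G) in
  mu / 4 * S k ^+ 2 <= h /\
  h <= inner g (x k) G (hess g f (x k) G) + betaH * S k * S k ^+ 2.
Proof.
move=> [_ [Nx _] /andP[lx _] [_ bS _] _] G h.
have [lH _ /(_ Nx) opn] := hA3 k.
have lB : linear (fun v => H k v - hess g f (x k) v).
  move=> a u v; rewrite lH (hess_linear g f hf (x k)).
  by rewrite scalerBr opprD addrACA.
have := inner_opnorm g (x k) _ G lB.
have -> : inner g (x k) G (H k G - hess g f (x k) G) =
    h - inner g (x k) G (hess g f (x k) G).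
  by rewrite -![inner _ _ _ _]/(bil (g (x k)) _ _) bilDr bilNr.
move=> o1; have {o1} : `|h - inner g (x k) G (hess g f (x k) G)| <= betaH * S k * S k ^+ 2.
  by apply: le_trans o1 _; rewrite ler_wpM2r // sqr_ge0.
have : betaH * S k * S k ^+ 2 <= mu / 4 * S k ^+ 2 by rewrite ler_wpM2r ?sqr_ge0.
rewrite ler_norml => e1 /andP[e2 e3]; split; last by rewrite -lerBlDl.
move: lx e1 e2; rewrite -/G; set q := S k ^+ 2; set p := betaH * _ * _.
set h0 := inner _ _ _ _ => lx e1 e2; lra.
Qed.

(** The radius clause is a disjunction because [D k] may exceed [Dbar], and the enlargement rule
    then cuts it down to [Dbar]. *)
Lemma tame_step k : tame (x k) -> 0 < S k -> exists t,
  let G := grad g f (x k) in let h := inner g (x k) G (H k G) in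
  [/\ 0 < t, t * (mu / 4) <= 1, t = D k / S k \/ t * h = S k ^+ 2,
      t * S k ^+ 2 / 2 <= t * S k ^+ 2 - 2^-1 * (t * (t * h)) &
      [/\ (1 - C * S k) * (t * S k ^+ 2 - 2^-1 * (t * (t * h))) <= gap k - gap k.+1,
      D k <= D k.+1 \/ Dbar <= D k.+1, f xbar <= f (x k.+1), dom i (x k.+1) &
      `|phi i (x k.+1) - phi i (x k)| <= C1 * (t * S k)]].
Proof.
move=> tk S0; have [mh _] := tame_curvature _ tk.
have [_ [Nx _] _ [_ _ CS] Rx] := tk.
have [lH _ /(_ Nx) opn] := hA3 k.
have [Dk sD xk1 Dk1] := htr k.
have mu4 : 0 < mu / 4 by rewrite divr_gt0.
have [|t [ns [t0 tm] tD tc [dge act rho]]] := @cauchy_tr_step R n M g Rt f hf (x k) (H k) (D k)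
  (mu / 4) betaH LH Dk S0 mu4 b0 L0 lH mh opn CS.
  by move=> v /Rx[].
rewrite -hcs in ns act rho.
have {}xk1 : x k.+1 = Rt (x k) (s k).
  rewrite xk1 (lt_trans _ rho) //; case/andP: hrho => _ r4.
  by apply: lt_trans r4 _; lra.
have [A2k fR iR dR] : [/\ True, f xbar <= f (x k.+1), dom i (x k.+1) &
    `|phi i (x k.+1) - phi i (x k)| <= C1 * tnorm g (x k) (s k)].
  have [|_ fR iR dR] := Rx (s k); last by rewrite xk1.
  by rewrite ns mulrAC -[leRHS]mul1r ler_wpM2r // ltW.
exists t; split => //; split => //.
- have -> : gap k - gap k.+1 = f (x k) - f (x k.+1) by rewrite /gap; ring.
  by rewrite xk1.
- rewrite Dk1.
  have -> : (tr_ratio g f Rt (x k) (H k) (s k) < 1 / 4) = false.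
    apply/negbTE; rewrite -leNgt ltW //; apply: lt_trans rho; lra.
  case: ifP => _; last by left.
  rewrite /Num.min; case: ifP => _; last by right.
  by left; rewrite mulr_natl mulr2n lerDl ltW.
- by rewrite -ns.
Qed.

Lemma tame_next k : dom i (x k) -> tame (x k) ->
  [/\ D k <= D k.+1 \/ Dbar <= D k.+1, 0 <= gap k.+1, gap k.+1 <= gap k, dom i (x k.+1) &
  `|phi i (x k.+1) - phi i (x k)| <=
    length_bound * (Num.sqrt (gap k) - Num.sqrt (gap k.+1))].
Proof.
move=> ixk tk; have [[fx PLx] _ _ _ _] := tk.
have [S0|S0] := eqVneq (S k) 0.
  have [xE DE] := critical_step _ S0.
  rewrite /gap xE DE subr_ge0 !subrr normr0 mulr0; split => //; by left.
have {}S0 : 0 < S k by rewrite lt_neqAle eq_sym S0 tnorm_ge0.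
have [t [t0 tm _ dge [act DD fx1 ix1 dphi]]] := tame_step _ tk S0.
have [_ _ _ [_ _ CS] _] := tk.
(* 3/8 is 3/4, the guaranteed share of the model decrease, times 1/2, the share of the linear
   decrease in the model decrease. *)
have act' : 3 / 8 * (t * S k * S k) <= gap k - gap k.+1.
  apply: le_trans act.
  apply: (@le_trans _ _ (3 / 4 * (t * S k ^+ 2 / 2))).
    by rewrite expr2; set q := S k; rewrite le_eqVlt; apply/orP; left; apply/eqP; field.
  apply: ler_pM => //; first by rewrite divr_ge0 // mulr_ge0 ?sqr_ge0 // ltW.
  by move: CS; set q := C * _ => CS; lra.
have tS0 : 0 <= t * S k by rewrite mulr_ge0 ?tnorm_ge0 // ltW.
have g1 : 0 <= gap k.+1 by rewrite subr_ge0.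
split => //.
  by rewrite -subr_ge0 (le_trans _ act') // mulr_ge0 // mulr_ge0 // ltW.
apply: le_trans dphi _.
have c0 : 0 <= (3 / 8 : R) by lra.
have := sqrt_decrease _ _ _ _ _ _ _ g1 c0 tS0 S0 mu0 PLx act'.
rewrite /length_bound -[gap k]/(gap k) -/(gap k).
have nu0 : 0 < 3 / 8 * Num.sqrt (mu / 2) by rewrite mulr_gt0 ?sqrtr_gt0 ?divr_gt0.
set nu := 3 / 8 * _ in nu0 *; move=> sd.
rewrite mulrAC ler_pdivlMr // -mulrA ler_wpM2l // mulrC.
exact: sd.
Qed.

End TameStep.

(** * Convergence of the iterates *)

Section Sequences.
Context {R : realType}.

Lemma iter_contraction (u : nat -> R) (q : R) (k0 : nat) : 0 <= q ->
  (forall k, (k0 <= k)%N -> u k.+1 <= q * u k) ->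
  forall j, u (k0 + j)%N <= q ^+ j * u k0.
Proof.
move=> q0 hu; elim=> [|j IH]; first by rewrite addn0 expr0 mul1r.
rewrite addnS exprS -mulrA; apply: le_trans (hu _ (leq_addr _ _)) _.
exact: ler_wpM2l.
Qed.

Lemma near_geometric_lt (a q e : R) : 0 <= q < 1 -> 0 < e ->
  exists k1, forall k, (k1 <= k)%N -> a * q ^+ k < e.
Proof.
move=> /andP[q0 q1] e0.
have := @cvg_geometric R a q; rewrite ger0_norm // => /(_ q1).
move=> /cvgrPdist_lt/(_ e e0)[k1 _ hk]; exists k1 => k k1k.
have := hk k k1k; rewrite sub0r normrN /geometric /= => h.
exact: le_lt_trans (ler_norm _) h.
Qed.

Lemma root_limsup_le (u : nat -> \bar R) (q : R) : 0 <= q ->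
  (forall k, (0 <= u k)%E) ->
  (forall q', q < q' -> \forall k \near \oo, (u k <= (q' ^+ k)%:E)%E) ->
  (limn_esup (fun k => poweR (u k) (k%:R^-1)%R) <= q%:E)%E.
Proof.
move=> q0 u0 hu; apply/lee_addgt0Pr => e e0; rewrite -EFinD.
have [k1 _ hk] := hu (q + e) (ltr_pwDr e0 (lexx q)).
rewrite /limn_esup limf_esupE; apply: ereal_inf_le.
(* The tail starts after [k1] so that [k] is positive: at [k = 0] the exponent [k%:R^-1] is 0. *)
exists (ereal_sup [set poweR (u k) (k%:R^-1) | k in [set k | (k1.+1 <= k)%N]]).
  exists [set k | (k1.+1 <= k)%N] => //.
  by exists k1.+1.
apply: ge_ereal_sup => _ [k /= k1k <-].
have qe : 0 <= q + e by rewrite addr_ge0 // ltW.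
have k0 : k%:R != 0 :> R by rewrite pnatr_eq0 -lt0n (leq_trans _ k1k).
apply: (@le_trans _ _ (poweR ((q + e) ^+ k)%:E k%:R^-1)).
  apply: gt0_ler_poweR.
  - by rewrite invr_ge0.
  - by rewrite in_itv /= u0 leey.
  - by rewrite in_itv /= leey lee_fin exprn_ge0.
  - by apply: hk; exact: ltnW.
by rewrite poweR_EFin -powR_mulrn // -powRrM mulfV // powRr1.
Qed.

Lemma contraction_rate_slack (mu l Q : R) : 0 < mu -> 0 < l -> 1 - mu / l < Q ->
  exists2 e, 0 < e <= 1 & 1 - (1 - e) * mu / (l + 2 * e) <= Q.
Proof.
move=> mu0 l0 hQ; pose a := 1 - Q.
have al : a * l < mu.
  by rewrite -ltr_pdivlMr // /a; set z := mu / l in hQ *; lra.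
have [a0|a0] := leP a 0.
  exists 1; first by rewrite ltr01 lexx.
  by rewrite subrr !mul0r subr0; rewrite /a in a0; lra.
have s0 : 0 < mu + 2 * a by rewrite addr_gt0 // mulr_gt0.
(* The goal amounts to [a * (l + 2 * e) <= (1 - e) * mu], which is linear in [e]; this is its
   solution, capped at 1. *)
pose e := Num.min 1 ((mu - a * l) / (mu + 2 * a)).
have e0 : 0 < e by rewrite lt_min ltr01 divr_gt0 // subr_gt0.
have e1 : e <= 1 by rewrite ge_min lexx.
have e2 : e * (mu + 2 * a) <= mu - a * l by rewrite -ler_pdivlMr // ge_min lexx orbT.
exists e; first by rewrite e0.
have l2 : 0 < l + 2 * e by rewrite addr_gt0 // mulr_gt0.
have : a <= (1 - e) * mu / (l + 2 * e).
  by rewrite ler_pdivlMr //; clear -e2; nra.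
by rewrite /a; set z := _ / _; lra.
Qed.

End Sequences.

Section DistanceBounds.
Context {R : realType} {n : nat} {M : smoothManifold R n}.
Context (g : riemannianMetric M).

Lemma rdist_ge0 (x y : M) : (0 <= rdist g x y)%E.
Proof.
apply: le_ereal_inf_tmp => _ [c _ <-]; apply: sume_ge0 => h _.
by apply: integral_ge0 => t _; rewrite lee_fin tnorm_ge0.
Qed.

Lemma near_rdist_le i (y0 : 'rV[R]_n) : img i y0 ->
  exists2 K : R, 0 <= K & \forall y \near y0,
    (rdist g (psi i y : M) (psi i y0) <= (K * `|y0 - y|)%:E)%E.
Proof.
move=> iy; have [K K0 NK] := near_norm_equiv g _ _ iy.
have [r r0 rB] := near_norm_ball _ _ _ NK.
exists (Num.sqrt K); first exact: sqrtr_ge0.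
have Ny : \forall y \near y0, `|y - y0| < r.
  by apply/nbhs_ballP; exists r => // y; rewrite -ball_normE /= distrC.
apply: filterS Ny => y yr; apply: (rdist_segment_le g i y0 _ _ r) => //.
- move=> w /rB[iw /(_ (y0 - y))[_ h]]; split => //.
  by rewrite exprMn sqr_sqrtr // ltW.
- by rewrite subrr normr0.
Qed.

End DistanceBounds.

(** * The iterates after they enter the neighborhood *)

Section Trajectory.
Context {R : realType} {n : nat} {M : smoothManifold R n}.
Context (g : riemannianMetric M) (Rt : M -> 'rV[R]_n -> M).
Context (f : M -> R) (xbar : M) (mu betaH LH : R) (N U : set M).
Context (Lam C1 rho' Dbar : R).
Hypotheses (hRt : is_retraction Rt) (hf : Ck_fun 2 f).
Hypotheses (mu0 : 0 < mu) (b0 : 0 <= betaH) (L0 : 0 <= LH) (C10 : 0 <= C1).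
Hypotheses (Lam0 : 0 < Lam).
Hypotheses (hrho : 0 < rho' < 1 / 4) (hDbar : 0 < Dbar).
Context (x : nat -> M) (D : nat -> R) (H : nat -> 'rV[R]_n -> 'rV[R]_n)
  (s : nat -> 'rV[R]_n).
Hypotheses (htr : trust_region g f Rt rho' Dbar x D H s)
  (hcs : cauchy_steps g f x D H s) (hA3 : hyp_A3 g f betaH N x H).

Local Notation i := (chart_at xbar).
Local Notation tame := (tame g Rt f xbar mu betaH LH N U Lam C1).
Local Notation S k := (tnorm g (x k) (grad g f (x k))).
Local Notation C := (decrease_defect mu betaH LH).
Local Notation gap := (gap f xbar x).
Local Notation K := (length_bound mu C1).

Context (r : R) (k0 : nat).
Hypothesis hball : forall y, `|y - phi i xbar| < r -> img i y /\ tame (psi i y).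
Hypotheses (ix0 : dom i (x k0)) (near0 : `|phi i (x k0) - phi i xbar| < r / 2).
Hypothesis gap0 : K * Num.sqrt (gap k0) < r / 2.

Let next := tame_next g Rt f xbar mu betaH LH N U Lam C1 rho' Dbar hRt hf mu0 b0
  L0 C10 hrho x D H s htr hcs hA3.
Let step := tame_step g Rt f xbar mu betaH LH N U Lam C1 rho' Dbar hf mu0 b0
  L0 hrho x D H s htr hcs hA3.
Let K0 : 0 <= K := length_bound_ge0 mu C1 C10.

Lemma tame_ball k : dom i (x k) -> `|phi i (x k) - phi i xbar| < r -> tame (x k).
Proof. by move=> ix /hball[_]; rewrite phiK. Qed.

(** The displacements telescope, so the iterates stay within [K * Num.sqrt (gap k0) < r / 2] of the
    entry point, which is itself within [r / 2] of the center. Thus the next iterate is again in the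
    ball where [tame] holds. *)
Lemma captured k : (k0 <= k)%N -> [/\ dom i (x k), tame (x k), 0 <= gap k,
  Num.sqrt (gap k) <= Num.sqrt (gap k0) &
  `|phi i (x k) - phi i (x k0)| <= K * (Num.sqrt (gap k0) - Num.sqrt (gap k))].
Proof.
have tg k' : tame (x k') -> 0 <= gap k' by move=> [[fx _] _ _ _ _]; rewrite subr_ge0.
have r2 : r / 2 < r.
  have : 0 < r / 2 by exact: le_lt_trans near0.
  lra.
move=> k0k; rewrite -(subnKC k0k); elim: (k - k0)%N => [|l].
  have t0 : tame (x k0) by apply: tame_ball => //; exact: lt_trans near0 r2.
  by rewrite addn0 !subrr normr0 mulr0; split => //; exact: tg.
rewrite addnS; set k' := (k0 + l)%N => -[ix tx gx sx px].
have [_ g1 g2 ix1 px1] := next _ ix tx.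
have sk := ler_wsqrtr g2.
have path : `|phi i (x k'.+1) - phi i (x k0)| <=
    K * (Num.sqrt (gap k0) - Num.sqrt (gap k'.+1)).
  apply: le_trans (ler_distD (phi i (x k')) _ _) _.
  by apply: le_trans (lerD px1 px) _; rewrite -mulrDr addrC subrKA.
split => //; last exact: le_trans sk sx.
apply: tame_ball => //; apply: le_lt_trans (ler_distD (phi i (x k0)) _ _) _.
rewrite (splitr r) ltrD //; apply: le_lt_trans path _; apply: le_lt_trans gap0.
by rewrite ler_wpM2l // gerBl sqrtr_ge0.
Qed.

Lemma captured_path k l : (k0 <= k)%N -> (k <= l)%N ->
  `|phi i (x l) - phi i (x k)| <= K * Num.sqrt (gap k).
Proof.
move=> k0k kl; apply: (@le_trans _ _ (K * (Num.sqrt (gap k) - Num.sqrt (gap l)))).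
  rewrite -(subnKC kl); elim: (l - k)%N => [|j IH].
    by rewrite addn0 !subrr normr0 mulr0.
  have kj : (k0 <= k + j)%N by rewrite (leq_trans k0k) // leq_addr.
  have [ix tx _ _ _] := captured _ kj.
  have [_ _ _ _ px1] := next _ ix tx.
  rewrite addnS; apply: le_trans (ler_distD (phi i (x (k + j)%N)) _ _) _.
  by apply: le_trans (lerD px1 IH) _; rewrite -mulrDr addrC subrKA.
by rewrite ler_wpM2l // gerBl sqrtr_ge0.
Qed.

Lemma captured_radius k : (k0 <= k)%N -> Num.min (D k0) Dbar <= D k.
Proof.
elim: k => [|k IH]; first by rewrite leqn0 => /eqP <-; rewrite ge_min lexx.
rewrite leq_eqVlt => /orP[/eqP <-|]; first by rewrite ge_min lexx.
rewrite ltnS => k0k; have [ix tx _ _ _] := captured _ k0k.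
have [[DD|DD] _ _ _ _] := next _ ix tx; first exact: le_trans (IH k0k) DD.
by rewrite ge_min DD orbT.
Qed.

Lemma radius_bound_gt0 : 0 < Num.min (D k0) Dbar.
Proof. by rewrite lt_min hDbar andbT; have [] := htr k0. Qed.

(** A coarse factor, dependent on the radius at entry, whose role is to send the gap to 0 and so
    produce a limit. *)
Lemma gap_contraction : exists2 q, 0 <= q < 1 &
  forall k, (k0 <= k)%N -> gap k.+1 <= q * gap k.
Proof.
have Dm0 := radius_bound_gt0; set Dm := Num.min _ _ in Dm0.
have L1 : 0 < Lam + mu / 4 by rewrite addr_gt0 // divr_gt0.
(* Lower bound for the Cauchy time: [D k / S k >= Dm] since [S k <= 1], and the unconstrained
   minimizer is at least the inverse of the upper curvature bound for [H k]. *)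
pose tau := Num.min Dm (Lam + mu / 4)^-1.
have tau0 : 0 < tau by rewrite lt_min Dm0 invr_gt0.
exists (Num.max 0 (1 - 3 / 4 * tau * mu)).
  by rewrite le_max lexx gt_max ltr01 gtrBl !mulr_gt0.
move=> k k0k; have [ix tx gx _ _] := captured _ k0k.
have [_ _ g2 _ _] := next _ ix tx.
have [[_ PLx] _ /andP[_ ux] [S1 bS CS] _] := tx.
have [S0|S0] := eqVneq (S k) 0.
  have gk : gap k = 0.
    by apply/eqP; rewrite eq_le gx andbT; move: PLx; rewrite S0 expr0n mulr0.
  by rewrite gk mulr0 -gk.
have {}S0 : 0 < S k by rewrite lt_neqAle eq_sym S0 tnorm_ge0.
apply: (@le_trans _ _ ((1 - 3 / 4 * tau * mu) * gap k)); last first.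
  by rewrite ler_wpM2r // le_max lexx orbT.
have [t [t0 tm tc dge [act _ _ _ _]]] := step _ tx S0.
have [_ hh] := tame_curvature g Rt f xbar mu betaH LH N U Lam C1 hf x H hA3 k tx.
have S2 : 0 < S k ^+ 2 by rewrite exprn_gt0.
have tt : tau <= t.
  rewrite ge_min; apply/orP; case: tc => tE; [left|right].
    rewrite tE ler_pdivlMr //; apply: le_trans (captured_radius _ k0k).
    by rewrite -/Dm ler_piMr // ltW.
  rewrite -[leLHS]mul1r ler_pdivrMr // -(ler_pM2r S2) mul1r -{1}tE -mulrA.
  rewrite ler_wpM2l ?(ltW t0) //; apply: le_trans hh _.
  by rewrite mulrDl lerD // ler_wpM2r // ltW.
have act' : 3 / 8 * (tau * S k ^+ 2) <= gap k - gap k.+1.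
  apply: le_trans act; apply: (@le_trans _ _ (3 / 4 * (t * S k ^+ 2 / 2))).
    apply: (@le_trans _ _ (3 / 8 * (t * S k ^+ 2))).
      by rewrite ler_wpM2l // ler_wpM2r // ltW.
    by rewrite le_eqVlt; apply/orP; left; apply/eqP; field.
  apply: ler_pM => //; first by rewrite divr_ge0 // mulr_ge0 ?sqr_ge0 // ltW.
  by move: CS; set z := C * _ => CS; lra.
have PL2 : 3 / 4 * tau * mu * gap k <= 3 / 8 * (tau * S k ^+ 2).
  have -> : 3 / 8 * (tau * S k ^+ 2) = 3 / 4 * tau * mu * (1 / (2 * mu) * S k ^+ 2).
    by field; rewrite gt_eqF.
  by rewrite ler_wpM2l // !mulr_ge0 // ltW.
rewrite mulrBl mul1r lerBrDr -lerBrDl; exact: le_trans PL2 act'.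
Qed.

Lemma gap_lt e : 0 < e -> exists2 k1, (k0 <= k1)%N &
  forall k, (k1 <= k)%N -> gap k < e.
Proof.
move=> e0; have [q q01 hq] := gap_contraction.
have [k1 hk] := near_geometric_lt (gap k0) q e q01 e0.
case/andP: q01 => q0 _.
exists (k0 + k1)%N; first exact: leq_addr.
move=> k kk; have k0k : (k0 <= k)%N by rewrite (leq_trans _ kk) // leq_addr.
rewrite -(subnKC k0k); apply: le_lt_trans (iter_contraction _ _ _ q0 hq _) _.
by rewrite mulrC; apply: hk; rewrite leq_subRL.
Qed.

Lemma captured_limit : exists yoo : 'rV[R]_n,
  phi i (x k) @[k --> \oo] --> yoo /\
  forall k, (k0 <= k)%N -> `|yoo - phi i (x k)| <= K * Num.sqrt (gap k).
Proof.
pose y k := phi i (x k).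
have cy : cvg (y k @[k --> \oo]).
  apply: cauchy_cvg; apply: cauchy_exP => e e0.
  have K1 : 0 < K + 1 by rewrite ltr_wpDl.
  have d0 : 0 < (e / (K + 1)) ^+ 2 by rewrite exprn_gt0 // divr_gt0.
  have [k1 k01 hk] := gap_lt _ d0.
  exists (y k1); exists k1 => // l /= k1l.
  rewrite -ball_normE /= distrC; apply: le_lt_trans (captured_path _ _ k01 k1l) _.
  apply: (@le_lt_trans _ _ ((K + 1) * Num.sqrt (gap k1))).
    by rewrite ler_wpM2r ?sqrtr_ge0 // lerDl.
  rewrite mulrC -ltr_pdivlMr // -(ltr_pXn2r (n := 2)) ?nnegrE ?sqrtr_ge0 //.
    have [_ _ g1 _ _] := captured _ k01.
    by rewrite sqr_sqrtr //; exact: hk.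
  by rewrite ltW // divr_gt0.
exists (lim (y k @[k --> \oo])); split => // k k0k.
apply/ler_addgt0Pr => e e0.
have /cvgrPdist_lt/(_ e e0)[k1 _ hk] := cy.
have := hk (maxn k k1) (leq_maxr _ _); rewrite /= => h1.
have h2 := captured_path _ _ k0k (leq_maxl k k1).
apply: le_trans (ler_distD (y (maxn k k1)) _ _) _; rewrite addrC.
by apply: lerD => //; exact: ltW.
Qed.

Lemma eventual_gap_rate (xoo : M) (q : R) :
  x k @[k --> \oo] --> xoo -> grad g f xoo = 0 ->
  Num.sqrt (1 - mu / lambda_max (hess g f xoo)) < q ->
  exists2 k1, (k0 <= k1)%N & forall k, (k1 <= k)%N -> gap k.+1 <= q ^+ 2 * gap k.
Proof.
set l := lambda_max _ => xcvg gxoo hq.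
have q0 : 0 < q by apply: le_lt_trans hq; exact: sqrtr_ge0.
have ev (P : set M) : nbhs xoo P -> exists2 k1, (k0 <= k1)%N &
    forall k, (k1 <= k)%N -> P (x k).
  move=> /xcvg[k1 _ hk]; exists (maxn k0 k1); first exact: leq_maxl.
  by move=> k kk; apply: hk; rewrite /= (leq_trans _ kk) // leq_maxr.
have gap_crit k : (k0 <= k)%N -> S k = 0 -> gap k.+1 <= q ^+ 2 * gap k.
  move=> k0k Sk; have [ix tx gx _ _] := captured _ k0k.
  have [_ _ g2 _ _] := next _ ix tx.
  have [[_ PLx] _ _ _ _] := tx.
  have gk : gap k = 0.
    by apply/eqP; rewrite eq_le gx andbT; move: PLx; rewrite Sk expr0n mulr0.
  by rewrite gk mulr0 -gk.
have mu4 : 0 < mu / 4 by rewrite divr_gt0.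
(* If [l <= 0], as in dimension 0, the curvature bounds [mu / 2] from below and [l + mu / 4] from
   above are incompatible unless the gradient is zero, so the gap eventually vanishes. *)
have [l0|l0] := leP l 0.
  have [k1 k01 hk] := ev _ (near_hess_le g f hf _ _ gxoo mu4).
  exists k1 => // k k1k; have k0k := leq_trans k01 k1k.
  apply: gap_crit => //; have [_ tx _ _ _] := captured _ k0k.
  have [_ _ /andP[lx _] _ _] := tx.
  apply/eqP/contraT => Sk; have S2 : 0 < S k ^+ 2 by rewrite exprn_even_gt0.
  have := le_trans lx (hk k k1k); rewrite -tnorm_sqr ler_pM2r //.
  rewrite -/l leNgt => /negP[]; rewrite -ltrBrDr; apply: le_lt_trans l0 _.
  by rewrite subr_gt0 ltr_pM2l // ltf_pV2 ?posrE // ltr_nat.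
have q2 : 1 - mu / l < q ^+ 2.
  have [neg|pos] := leP (1 - mu / l) 0; first by rewrite (le_lt_trans neg) // exprn_gt0.
  by rewrite -[X in X < _]sqr_sqrtr ?(ltW pos) // ltr_pXn2r ?nnegrE ?sqrtr_ge0 // ltW.
have [e /andP[e0 e1] he] := contraction_rate_slack _ _ _ mu0 l0 q2.
have Dm0 := radius_bound_gt0; set Dm := Num.min _ _ in Dm0.
have c0 : 0 <= C by exact: decrease_defect_ge0.
(* A gradient below [eta] makes the decrease defect at most [e], makes [H k] differ from the Hessian
   by at most [e] along the gradient, and leaves the radius inactive. *)
pose eta := Num.min (e / (C + 1)) (Num.min (e / (betaH + 1)) (Dm * (mu / 4))).
have eta0 : 0 < eta.
  by rewrite !lt_min !(divr_gt0, mulr_gt0) // ltr_wpDl.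
have [k1 k01 hk] := ev _ (filterI (near_hess_le g f hf _ _ gxoo e0)
  (near_tnorm_grad g f hf _ _ gxoo eta0)).
exists k1 => // k k1k; have k0k := leq_trans k01 k1k.
have [S0|S0] := eqVneq (S k) 0; first exact: gap_crit.
have {}S0 : 0 < S k by rewrite lt_neqAle eq_sym S0 tnorm_ge0.
have [ix tx gx _ _] := captured _ k0k.
have [[_ PLx] _ _ _ _] := tx.
have [t [t0 tm tc dge [act _ _ _ _]]] := step _ tx S0.
have [_ hh] := tame_curvature g Rt f xbar mu betaH LH N U Lam C1 hf x H hA3 k tx.
have [hx] := hk k k1k; rewrite !lt_min => /andP[s1 /andP[s2 s3]].
have CS : C * S k <= e.
  apply: (@le_trans _ _ ((C + 1) * S k)); first by rewrite ler_wpM2r ?tnorm_ge0 // lerDl.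
  by rewrite mulrC -ler_pdivlMr ?ltr_wpDl // ltW.
have bS : betaH * S k <= e.
  apply: (@le_trans _ _ ((betaH + 1) * S k)); first by rewrite ler_wpM2r ?tnorm_ge0 // lerDl.
  by rewrite mulrC -ler_pdivlMr ?ltr_wpDl // ltW.
have S2 : 0 < S k ^+ 2 by rewrite exprn_gt0.
(* An active radius would give [D k = t * S k <= 4 / mu * S k < Dm], contrary to
   [captured_radius]. *)
have th : t * inner g (x k) (grad g f (x k)) (H k (grad g f (x k))) = S k ^+ 2.
  case: tc => // tD; have := captured_radius _ k0k; rewrite -/Dm leNgt => /negP[].
  have -> : D k = t * S k by rewrite tD divfK // gt_eqF.
  rewrite -(ltr_pM2r mu4) mulrAC; apply: le_lt_trans s3.
  by rewrite -[leRHS]mul1r ler_wpM2r // ltW.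
have l2 : 0 < l + 2 * e by rewrite addr_gt0 // mulr_gt0.
have hl : inner g (x k) (grad g f (x k)) (H k (grad g f (x k))) <=
    (l + 2 * e) * S k ^+ 2.
  apply: le_trans hh _; move: hx; rewrite -tnorm_sqr -/l => hx.
  have -> : (l + 2 * e) * S k ^+ 2 = (l + e) * S k ^+ 2 + e * S k ^+ 2 by ring.
  by rewrite lerD // ler_wpM2r // ltW.
have tl : (l + 2 * e)^-1 <= t.
  rewrite -[leLHS]mul1r ler_pdivrMr // -(ler_pM2r S2) mul1r -{1}th -mulrA.
  by rewrite ler_wpM2l // ltW.
have act' : (1 - e) * ((l + 2 * e)^-1 * (S k ^+ 2 / 2)) <= gap k - gap k.+1.
  apply: le_trans act; rewrite th; apply: ler_pM.
  - by rewrite subr_ge0.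
  - by rewrite mulr_ge0 ?divr_ge0 ?invr_ge0 // ltW.
  - by rewrite lerD2l lerN2.
  - have -> : t * S k ^+ 2 - 2^-1 * (t * S k ^+ 2) = t * (S k ^+ 2 / 2) by field.
    by rewrite ler_wpM2r // divr_ge0 // ltW.
have PL2 : (1 - e) * mu / (l + 2 * e) * gap k <=
    (1 - e) * ((l + 2 * e)^-1 * (S k ^+ 2 / 2)).
  have -> : (1 - e) * ((l + 2 * e)^-1 * (S k ^+ 2 / 2)) =
      (1 - e) * mu / (l + 2 * e) * (1 / (2 * mu) * S k ^+ 2).
    by field; rewrite !gt_eqF.
  by rewrite ler_wpM2l // divr_ge0 ?mulr_ge0 ?subr_ge0 // ltW.
apply: (@le_trans _ _ ((1 - (1 - e) * mu / (l + 2 * e)) * gap k)).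
  by rewrite mulrBl mul1r lerBrDr -lerBrDl; exact: le_trans PL2 act'.
by rewrite ler_wpM2r.
Qed.

Lemma captured_cvg : exists xoo : M,
  [/\ x k @[k --> \oo] --> xoo, U xoo, local_min f xoo, f xoo = f xbar &
    exists2 A, 0 <= A & exists2 k1, (k0 <= k1)%N & forall k, (k1 <= k)%N ->
      (rdist g (x k) xoo <= (A * Num.sqrt (gap k))%:E)%E].
Proof.
have [yoo [ycvg yd]] := captured_limit.
have yr : `|yoo - phi i xbar| < r.
  apply: le_lt_trans (ler_distD (phi i (x k0)) _ _) _; rewrite (splitr r) ltrD //.
  exact: le_lt_trans (yd k0 (leqnn _)) gap0.
have [iyoo [_ [_ Uoo] _ _ _]] := hball _ yr.
have xE : \forall k \near \oo, psi i (phi i (x k)) = x k.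
  by exists k0 => // k /= /captured[ix _ _ _ _]; rewrite phiK.
have xcvg : x k @[k --> \oo] --> (psi i yoo : M).
  have c : psi i (phi i (x k)) @[k --> \oo] --> (psi i yoo : M).
    exact: (continuous_cvg _ (psi_continuous _ _ _ iyoo) ycvg).
  by apply: cvg_trans c; apply: near_eq_cvg; apply: filterS xE => k ->.
have fE : f (psi i yoo) = f xbar.
  have cf : {for yoo, continuous (f \o psi i)}.
    by apply: differentiable_continuous; exact: coord_fun_diff.
  have c1 : f (x k) @[k --> \oo] --> f (psi i yoo).
    have c : (f \o psi i) (phi i (x k)) @[k --> \oo] --> f (psi i yoo).
      exact: (continuous_cvg _ cf ycvg).
    by apply: cvg_trans c; apply: near_eq_cvg; apply: filterS xE => k /= ->.
  have c2 : f (x k) @[k --> \oo] --> f xbar.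
    apply/cvgrPdist_lt => e e0; have [k1 k01 hk] := gap_lt _ e0.
    exists k1 => // k /= k1k; have [_ _ gx _ _] := captured _ (leq_trans k01 k1k).
    by rewrite distrC ger0_norm //; exact: hk.
  exact: (cvg_unique (@Rhausdorff R) c1 c2).
exists (psi i yoo); split => //.
  (* The limit lies in the open ball where [f] is at least [f xbar], and takes the value [f xbar];
     so it is a local minimum. *)
  have Nr : \forall y \near yoo, `|y - phi i xbar| < r.
    have r1 : 0 < r - `|yoo - phi i xbar| by rewrite subr_gt0.
    apply/nbhs_ballP; exists (r - `|yoo - phi i xbar|) => // y.
    rewrite -ball_normE /= ltrBrDr distrC => h.
    by apply: le_lt_trans (ler_distD yoo _ _) h.
  rewrite -{1}(psiK _ _ iyoo) in Nr.
  apply: filterS (near_phi _ _ _ (psi_dom _ _ iyoo) Nr) => z [iz zr].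
  by rewrite fE; have [_ [[]]] := hball _ zr; rewrite phiK.
have [A A0 NA] := near_rdist_le g _ _ iyoo.
exists (A * K); first by rewrite mulr_ge0.
have [k1 _ hk] := ycvg _ NA.
exists (maxn k0 k1); first exact: leq_maxl.
move=> k kk; have k0k : (k0 <= k)%N by rewrite (leq_trans _ kk) // leq_maxl.
have := hk k (leq_trans (leq_maxr _ _) kk); rewrite /=.
have [ix _ _ _ _] := captured _ k0k; rewrite (phiK _ _ _ ix) => /le_trans; apply.
by rewrite lee_fin -mulrA ler_wpM2l //; exact: yd.
Qed.

Lemma captured_linear_cvg : exists xoo : M,
  (U `&` local_minima_at f (f xbar)) xoo /\
  linear_cvg g x xoo (Num.sqrt (1 - mu / lambda_max (hess g f xoo))).
Proof.
have [xoo [xcvg Uoo fmin fE [A A0 [k1 k01 hA]]]] := captured_cvg.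
exists xoo; split => //; split => //.
apply: root_limsup_le; [exact: sqrtr_ge0|by move=> k; exact: rdist_ge0|].
set q := Num.sqrt _ => q2 qq2.
have q0 : 0 <= q by exact: sqrtr_ge0.
(* The square root of the gap contracts by [q1]; the spare factor [(q1 / q2) ^+ j] eventually
   absorbs the constant [B]. *)
pose q1 := (q + q2) / 2.
have qq1 : q < q1 by rewrite /q1 ltr_pdivlMr // mulr_natr mulr2n ltrD2l.
have q12 : q1 < q2 by rewrite /q1 ltr_pdivrMr // mulr_natr mulr2n ltrD2r.
have q10 : 0 < q1 by apply: le_lt_trans qq1.
have q20 : 0 < q2 by apply: lt_trans q12.
have [k2 k02 hk2] := eventual_gap_rate _ _ xcvg (local_min_grad g f hf _ fmin) qq1.
have rate j : Num.sqrt (gap (k2 + j)) <= q1 ^+ j * Num.sqrt (gap k2).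
  have := iter_contraction gap (q1 ^+ 2) k2 (sqr_ge0 _) hk2 j.
  move=> /ler_wsqrtr; rewrite sqrtrM ?exprn_ge0 ?(ltW q10) //.
  by rewrite -exprM mulnC exprM sqrtr_sqr ger0_norm // exprn_ge0 // ltW.
pose B := A * Num.sqrt (gap k2) / q2 ^+ k2.
have q01 : 0 <= q1 / q2 < 1 by rewrite divr_ge0 ?(ltW q10) ?(ltW q20) //= ltr_pdivrMr // mul1r.
have [k3 hk3] := near_geometric_lt B _ _ q01 ltr01.
exists (maxn k1 (k2 + k3)) => // k /= kk.
have k1k : (k1 <= k)%N by rewrite (leq_trans _ kk) // leq_maxl.
have k2k : (k2 + k3 <= k)%N by rewrite (leq_trans _ kk) // leq_maxr.
have kE : (k2 <= k)%N by rewrite (leq_trans _ k2k) // leq_addr.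
apply: le_trans (hA k k1k) _; rewrite lee_fin.
have := hk3 (k - k2)%N; rewrite leq_subRL // => /(_ k2k)/ltW.
have := rate (k - k2)%N; rewrite subnKC // => hr hB.
apply: (@le_trans _ _ (A * (q1 ^+ (k - k2) * Num.sqrt (gap k2)))).
  by rewrite ler_wpM2l.
have split_pow (a u p v w : R) : v != 0 -> w != 0 ->
    a * (p * u) = a * u / v * (p / w) * (v * w).
  by move=> v0 w0; field; rewrite v0 w0.
rewrite -[in leRHS](subnKC kE) exprD (split_pow _ _ _ (q2 ^+ k2) (q2 ^+ (k - k2))).
- by rewrite -expr_div_n -/B ler_piMl // mulr_ge0 // exprn_ge0 // ltW.
- by rewrite expf_neq0 // gt_eqF.
- by rewrite expf_neq0 // gt_eqF.
Qed.

End Trajectory.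

Theorem theorem4p9 (R : realType) (n : nat) (M : smoothManifold R n)
  (g : riemannianMetric M)
  (Rt : M -> 'rV[R]_n -> M) (hRt : is_retraction Rt)
  (hcr : exists2 cr : R, 1 <= cr & forall x0 : M,
     near_zero_vector g x0 (fun x s =>
       (rdist g (Rt x s) x <= (cr * tnorm g x s)%:E)%E))
  (f : M -> R) (hf : Ck_fun 2 f)
  (xbar : M) (hxbar : local_min f xbar)
  (rho' Dbar : R) (hrho' : 0 < rho' < 1 / 4) (hDbar : 0 < Dbar)
  (A2 : exists2 LH : R, 0 <= LH & near_zero_vector g xbar (fun x s =>
     f (Rt x s) - f x - inner g x s (grad g f x)
       - 2^-1 * inner g x s (hess g f x s) <= LH / 6 * tnorm g x s ^+ 3))
  (betaH : R) (hbetaH : 0 <= betaH) (N : set M) (hN : nbhs xbar N)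
  (mu : R) (hmu : 0 < mu)
  (PL : \forall x \near xbar,
     f x - f xbar <= 1 / (2 * mu) * tnorm g x (grad g f x) ^+ 2)
  (U : set M) (hU : nbhs xbar U) :
  exists2 V : set M, nbhs xbar V &
    forall (x : nat -> M) (D : nat -> R) (H : nat -> 'rV[R]_n -> 'rV[R]_n)
           (s : nat -> 'rV[R]_n),
      trust_region g f Rt rho' Dbar x D H s ->
      cauchy_steps g f x D H s ->
      hyp_A3 g f betaH N x H ->
      (exists k, V (x k)) ->
      exists xoo : M,
        (U `&` local_minima_at f (f xbar)) xoo /\
        linear_cvg g x xoo (Num.sqrt (1 - mu / lambda_max (hess g f xoo))).
Proof.
have [LH LH0 A2'] := A2.
have [Lam [C1 [Lam0 C10 Ht]]] := near_tame g Rt f xbar mu betaH LH N U hRt hf hxbar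
  A2' PL hN hU hmu hbetaH LH0.
pose i := chart_at xbar; have ix := dom_chart_at M xbar; have iy := img_phi _ _ ix.
have Ht' : \forall y \near phi i xbar, img i y /\
    tame g Rt f xbar mu betaH LH N U Lam C1 (psi i y).
  have T : \forall y \near phi i xbar,
      tame g Rt f xbar mu betaH LH N U Lam C1 (psi i y).
    by apply: (near_psi i _ (tame g Rt f xbar mu betaH LH N U Lam C1) iy); rewrite phiK.
  exact: filterI (near_img _ _ iy) T.
have [r r0 hball] := near_norm_ball _ _ _ Ht'.
have r2 : 0 < r / 2 by rewrite divr_gt0.
have cf : {for phi i xbar, continuous (f \o psi i)}.
  by apply: differentiable_continuous; exact: coord_fun_diff.
have Kb0 := length_bound_ge0 mu C1 C10; set K := length_bound mu C1 in Kb0.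
have K1 : 0 < K + 1 by rewrite ltr_wpDl.
pose e := (r / 2 / (K + 1)) ^+ 2.
have e0 : 0 < e by rewrite exprn_gt0 // divr_gt0.
have Ny : \forall y \near phi i xbar, `|y - phi i xbar| < r / 2.
  by apply/nbhs_ballP; exists (r / 2) => // y; rewrite -ball_normE /= distrC.
have Nf : \forall y \near phi i xbar, `|f xbar - f (psi i y)| < e.
  by have /cvgrPdist_lt/(_ e e0) := cf; rewrite /= phiK.
(* Half of [r] is for the entry point, half for the path still to come. No condition involves the
   trust-region radius or the index of entry. *)
exists [set x | [/\ dom i x, `|phi i x - phi i xbar| < r / 2 &
    K * Num.sqrt (f x - f xbar) < r / 2]].
  apply: filterS2 (near_phi _ _ _ ix Ny) (near_phi _ _ _ ix Nf) => x [ix' xr] [_ xf].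
  split => //; rewrite phiK // in xf.
  apply: (@le_lt_trans _ _ ((K + 1) * Num.sqrt (f x - f xbar))).
    by rewrite ler_wpM2r ?sqrtr_ge0 // lerDl.
  rewrite mulrC -ltr_pdivlMr //.
  have -> : r / 2 / (K + 1) = Num.sqrt e.
    by rewrite /e sqrtr_sqr ger0_norm // divr_ge0 // ltW.
  rewrite ltr_sqrt //; apply: le_lt_trans xf; rewrite distrC; exact: ler_norm.
move=> x D H s htr hcs hA3 [k0 [ix0 xr0 gap0]].
exact: (captured_linear_cvg g Rt f xbar mu betaH LH N U Lam C1 rho' Dbar hRt hf hmu
  hbetaH LH0 C10 Lam0 hrho' hDbar x D H s htr hcs hA3 r k0 hball ix0 xr0 gap0).
Qed.
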